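(* Let $(M,F)$ be a Finsler manifold of dimension $n\ge2$ whose flag curvature satisfies $\mathbf{K}(P,y)>0$ for all flags $P$ and all flagpoles $y\in P$. Suppose that $F$ is a non-zero constant isotropic Berwald metric, i.e. there is a constant $c\in\mathbb{R}$, $c\neq 0$, such that for all $x\in M$, $0\neq y\in T_xM$ and $u,v,w\in T_xM$, $$\mathbf{B}_y(u,v,w)=cF^{-1}\Big\{\mathbf{h}_y(u,v)\mathfrak{B}_y(w)+\mathbf{h}_y(v,w)\mathfrak{B}_y(u)+\mathbf{h}_y(w,u)\mathfrak{B}_y(v)+2F\,\mathbf{C}_y(u,v,w)\,\ell\Big\}.$$ Then $F$ is a Riemannian metric.
   Context: Let $M$ be an $n$-dimensional $C^\infty$ manifold, $TM_0=TM\setminus\{0\}$ the slit tangent bundle, with local coordinates $(x^i,y^i)$. A Finsler metric is a function $F:TM\to[0,\infty)$ that is $C^\infty$ on $TM_0$, satisfies $F(x,\lambda y)=\lambda F(x,y)$ for all $\lambda>0$, and such that for every $y\in T_xM\setminus\{0\}$ the form $\mathbf{g}_y(u,v)=\frac12\frac{\partial^2}{\partial s\partial t}F^2(y+su+tv)|_{s=t=0}$ is positive definite on $T_xM$; write $g_{ij}(x,y)$ for its components and $g^{ij}$ for the inverse matrix. $F$ is Riemannian if $F^2(x,y)$ is a positive definite quadratic form in $y$ for each $x$. The Cartan torsion is $\mathbf{C}_y(u,v,w)=\frac12\frac{d}{dt}[\mathbf{g}_{y+tw}(u,v)]_{t=0}$. The angular form is $\mathbf{h}_y(u,v)=\mathbf{g}_y(u,v)-F^{-2}(y)\mathbf{g}_y(y,u)\mathbf{g}_y(y,v)$.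 Also $\ell=\ell(x,y)=y/F(x,y)$ and $\mathfrak{B}_y(w)=w-\mathbf{g}_y(w,\ell)\ell$. The spray coefficients are $G^i=\frac14 g^{im}\left\{\frac{\partial^2 F^2}{\partial x^k\partial y^m}y^k-\frac{\partial F^2}{\partial x^m}\right\}$. The Berwald curvature is $\mathbf{B}_y(u,v,w)=B^i_{\ jkl}(y)u^jv^kw^l\frac{\partial}{\partial x^i}$ with $B^i_{\ jkl}=\frac{\partial^3G^i}{\partial y^j\partial y^k\partial y^l}$. The Riemann curvature $\mathbf{R}_y:T_xM\to T_xM$ is $\mathbf{R}_y(u)=R^i_{\ k}(y)u^k\frac{\partial}{\partial x^i}$ with $$R^i_{\ k}=2\frac{\partial G^i}{\partial x^k}-\frac{\partial^2G^i}{\partial x^j\partial y^k}y^j+2G^j\frac{\partial^2G^i}{\partial y^j\partial y^k}-\frac{\partial G^i}{\partial y^j}\frac{\partial G^j}{\partial y^k}.$$ A flag at $x$ is a $2$-plane $P\subset T_xM$ together with a flagpole $0\ne y\in P$; writing $P=\mathrm{span}\{y,u\}$, the flag curvature is $$\mathbf{K}(P,y)=\frac{\mathbf{g}_y(u,\mathbf{R}_y(u))}{\mathbf{g}_y(y,y)\mathbf{g}_y(u,u)-\mathbf{g}_y(y,u)^2},$$ which does not depend on the choice of $u$. *)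

(* Defs.v *)
From HB Require Import structures.
From mathcomp Require Import all_boot all_order all_algebra.
From mathcomp Require Import all_classical all_reals all_analysis.
Set Implicit Arguments.
Unset Strict Implicit.
Unset Printing Implicit Defensive.
Import Order.TTheory GRing.Theory Num.Theory.
Import numFieldNormedType.Exports.
Local Open Scope classical_set_scope.
Local Open Scope ring_scope.

(* [Ck k U f]: f is of class C^k on the open set U.  On finite-dimensional
   spaces, C^(k+1) means Fréchet differentiable with C^k derivative, and the
   derivative is C^k iff all the directional derivatives are. *)
Fixpoint Ck (R : realType) (V W : normedModType R) (k : nat) (U : set V)
    (f : V -> W) : Prop :=
  match k with
  | 0 => forall x, U x -> {for x, continuous f}
  | k'.+1 => (forall x, U x -> differentiable f x) /\
             (forall v : V, Ck k' U (fun x => 'D_v f x : W))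
  end.

Definition smooth_on (R : realType) (V W : normedModType R) (U : set V)
    (f : V -> W) : Prop := forall k, Ck k U f.

(* Outside [chart_dom] (resp. [chart_cod]) the values of the chart (resp. of
   its inverse) are irrelevant. *)
Record chart (R : realType) (n : nat) (M : topologicalType) := Chart {
  chart_dom : set M;
  chart_cod : set 'rV[R]_n;
  chart_fun :> M -> 'rV[R]_n;
  chart_inv : 'rV[R]_n -> M;
  chart_dom_open : open chart_dom;
  chart_cod_open : open chart_cod;
  chart_funP : forall p, chart_dom p -> chart_cod (chart_fun p);
  chart_invP : forall x, chart_cod x -> chart_dom (chart_inv x);
  chart_funK : forall p, chart_dom p -> chart_inv (chart_fun p) = p;
  chart_invK : forall x, chart_cod x -> chart_fun (chart_inv x) = x;
  chart_fun_continuous : forall p, chart_dom p -> {for p, continuous chart_fun};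
  chart_inv_continuous : forall x, chart_cod x -> {for x, continuous chart_inv}
}.

Definition transition (R : realType) (n : nat) (M : topologicalType)
    (c d : chart R n M) : 'rV[R]_n -> 'rV[R]_n := fun x => d (chart_inv c x).

Definition transition_dom (R : realType) (n : nat) (M : topologicalType)
    (c d : chart R n M) : set 'rV[R]_n :=
  [set x | chart_cod c x /\ chart_dom d (chart_inv c x)].

Record manifold (R : realType) (n : nat) := Manifold {
  mcarrier :> topologicalType;
  manifold_hausdorff : hausdorff_space mcarrier;
  manifold_second_countable : @second_countable mcarrier;
  atlas : set (chart R n mcarrier);
  atlas_cover : forall p : mcarrier, exists2 c, atlas c & chart_dom c p;
  atlas_smooth : forall c d, atlas c -> atlas d ->
    smooth_on (transition_dom c d) (transition c d)
}.

(* A tangent vector at [foot] is the family of its components in the charts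
   of the atlas around [foot], subject to the usual transformation law; the
   components in irrelevant charts are set to 0 so that equality of tangent
   vectors is the intended one. *)
Record tangent_bundle (R : realType) (n : nat) (M : manifold R n) :=
  TangentVector {
  foot : M;
  components : chart R n M -> 'rV[R]_n;
  components_transition : forall c d, atlas c -> atlas d ->
    chart_dom c foot -> chart_dom d foot ->
    components d = 'D_(components c) (transition c d) (c foot);
  components_out : forall c, ~ (atlas c /\ chart_dom c foot) ->
    components c = 0
}.

Definition coord_components (R : realType) (n : nat) (M : manifold R n)
    (c : chart R n M) (x y : 'rV[R]_n) (d : chart R n M) : 'rV[R]_n :=
  if pselect (atlas d /\ chart_dom d (chart_inv c x))
  then 'D_y (transition c d) x else 0.

Lemma open_transition_dom (R : realType) (n : nat) (M : manifold R n)
    (c d : chart R n M) : open (transition_dom c d).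
Proof.
rewrite openE => x [cx dx]; rewrite /interior/=; near=> z; split.
  by near: z; apply: open_nbhs_nbhs; split=> //; exact: chart_cod_open.
near: z; apply: (chart_inv_continuous cx).
by apply: open_nbhs_nbhs; split=> //; exact: chart_dom_open.
Unshelve. all: by end_near. Qed.

Lemma coord_components_transition (R : realType) (n : nat) (M : manifold R n)
    (c : chart R n M) (x y : 'rV[R]_n) :
  atlas c -> chart_cod c x ->
  forall d e, atlas d -> atlas e ->
    chart_dom d (chart_inv c x) -> chart_dom e (chart_inv c x) ->
    coord_components c x y e =
    'D_(coord_components c x y d) (transition d e) (d (chart_inv c x)).
Proof.
move=> Ac cx d e Ad Ae dx ex; rewrite /coord_components.
case: pselect => [?|[]//]; case: pselect => [?|[]//].
have Tcd : transition_dom c d x by [].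
have Tce : transition_dom c e x by [].
have Tde : transition_dom d e (transition c d x).
  by split; rewrite /transition ?chart_funK//; exact: chart_funP.
have dcd := (atlas_smooth Ac Ad 1).1 _ Tcd.
have dde := (atlas_smooth Ad Ae 1).1 _ Tde.
have -> : 'D_y (transition c e) x =
          'D_y (transition d e \o transition c d) x.
  apply: near_eq_derive; near=> z.
  have [cz dz] : transition_dom c d z.
    near: z; apply: open_nbhs_nbhs; split=> //; exact: open_transition_dom.
  by rewrite /transition/= chart_funK.
rewrite deriveE; last exact: differentiable_comp.
rewrite diff_comp//= -!deriveE//.
Unshelve. all: by end_near. Qed.

Lemma coord_components_out (R : realType) (n : nat) (M : manifold R n)
    (c : chart R n M) (x y : 'rV[R]_n) d :
  ~ (atlas d /\ chart_dom d (chart_inv c x)) -> coord_components c x y d = 0.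
Proof. by rewrite /coord_components; case: pselect. Qed.

(* The tangent vector y^i d/dx^i at the point of coordinates x. *)
Definition coord_vector (R : realType) (n : nat) (M : manifold R n)
    (c : chart R n M) (x y : 'rV[R]_n) (cx : atlas c /\ chart_cod c x) :
    tangent_bundle M :=
  TangentVector (coord_components_transition y cx.1 cx.2)
    (@coord_components_out R n M c x y).

(* The expression F(x, y) of a function on TM in the standard coordinates
   (x^i, y^i) of TM; the default value outside the chart is irrelevant. *)
Definition local_expr (R : realType) (n : nat) (M : manifold R n)
    (F : tangent_bundle M -> R) (c : chart R n M) (x y : 'rV[R]_n) : R :=
  match pselect (atlas c /\ chart_cod c x) with
  | left cx => F (coord_vector y cx)
  | right _ => 0
  end.

Lemma local_exprE (R : realType) (n : nat) (M : manifold R n)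
    (F : tangent_bundle M -> R) (c : chart R n M) (v : tangent_bundle M) :
  atlas c -> chart_dom c (foot v) ->
  F v = local_expr F c (c (foot v)) (components v c).
Proof.
move=> Ac cv; rewrite /local_expr; case: pselect => [cx|[]]; last first.
  by split=> //; exact: chart_funP.
congr F; move: cx; case: v cv => p w wt wo /= cp cx.
rewrite /coord_vector.
move: (coord_components_transition _ _ _) (@coord_components_out _ _ _ _ _ _).
have -> : coord_components c (c p) (w c) = w.
  apply/funext => d; rewrite /coord_components chart_funK//.
  by case: pselect => [[Ad dp]|/wo ->//]; rewrite -wt.
rewrite chart_funK// => wt' wo'.
by congr TangentVector; exact: Prop_irrelevance.
Qed.

(* Below, f : 'rV_n -> 'rV_n -> R is a function of the coordinates (x, y). *)

Definition basis_vec (R : realType) (n : nat) (i : 'I_n) : 'rV[R]_n :=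
  delta_mx 0 i.

Definition dx (R : realType) (n : nat) (i : 'I_n)
    (f : 'rV[R]_n -> 'rV[R]_n -> R) (x y : 'rV[R]_n) : R :=
  'D_(basis_vec R i) (fun z => f z y) x.

Definition dy (R : realType) (n : nat) (i : 'I_n)
    (f : 'rV[R]_n -> 'rV[R]_n -> R) (x y : 'rV[R]_n) : R :=
  'D_(basis_vec R i) (fun z => f x z) y.

Definition sqf (R : realType) (n : nat) (F : 'rV[R]_n -> 'rV[R]_n -> R)
    (x y : 'rV[R]_n) : R := F x y ^+ 2.

Definition fundamental_form (R : realType) (n : nat)
    (F : 'rV[R]_n -> 'rV[R]_n -> R) (x y u v : 'rV[R]_n) : R :=
  2^-1 * 'D_u (fun z => 'D_v (sqf F x) z : R) y.

Definition metric_mx (R : realType) (n : nat)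
    (F : 'rV[R]_n -> 'rV[R]_n -> R) (x y : 'rV[R]_n) : 'M[R]_n :=
  \matrix_(i, j) fundamental_form F x y (basis_vec R i) (basis_vec R j).

Definition cartan_torsion (R : realType) (n : nat)
    (F : 'rV[R]_n -> 'rV[R]_n -> R) (x y u v w : 'rV[R]_n) : R :=
  2^-1 * 'D_w (fun z => fundamental_form F x z u v) y.

Definition angular_form (R : realType) (n : nat)
    (F : 'rV[R]_n -> 'rV[R]_n -> R) (x y u v : 'rV[R]_n) : R :=
  fundamental_form F x y u v
  - (F x y) ^- 2 * fundamental_form F x y y u * fundamental_form F x y y v.

Definition unit_vec (R : realType) (n : nat)
    (F : 'rV[R]_n -> 'rV[R]_n -> R) (x y : 'rV[R]_n) : 'rV[R]_n :=
  (F x y)^-1 *: y.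

Definition angular_proj (R : realType) (n : nat)
    (F : 'rV[R]_n -> 'rV[R]_n -> R) (x y w : 'rV[R]_n) : 'rV[R]_n :=
  w - fundamental_form F x y w (unit_vec F x y) *: unit_vec F x y.

Definition spray (R : realType) (n : nat)
    (F : 'rV[R]_n -> 'rV[R]_n -> R) (i : 'I_n) (x y : 'rV[R]_n) : R :=
  4^-1 * \sum_(m < n) invmx (metric_mx F x y) i m *
    (\sum_(k < n) dx k (dy m (sqf F)) x y * y 0 k - dx m (sqf F) x y).

Definition berwald_coef (R : realType) (n : nat)
    (F : 'rV[R]_n -> 'rV[R]_n -> R) (i j k l : 'I_n) (x y : 'rV[R]_n) : R :=
  dy j (dy k (dy l (spray F i))) x y.

Definition berwald_curvature (R : realType) (n : nat)
    (F : 'rV[R]_n -> 'rV[R]_n -> R) (x y u v w : 'rV[R]_n) : 'rV[R]_n :=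
  \row_i \sum_(j < n) \sum_(k < n) \sum_(l < n)
    berwald_coef F i j k l x y * u 0 j * v 0 k * w 0 l.

Definition riemann_coef (R : realType) (n : nat)
    (F : 'rV[R]_n -> 'rV[R]_n -> R) (i k : 'I_n) (x y : 'rV[R]_n) : R :=
  2 * dx k (spray F i) x y
  - \sum_(j < n) dx j (dy k (spray F i)) x y * y 0 j
  + 2 * (\sum_(j < n) spray F j x y * dy j (dy k (spray F i)) x y)
  - \sum_(j < n) dy j (spray F i) x y * dy k (spray F j) x y.

Definition riemann_curvature (R : realType) (n : nat)
    (F : 'rV[R]_n -> 'rV[R]_n -> R) (x y u : 'rV[R]_n) : 'rV[R]_n :=
  \row_i \sum_(k < n) riemann_coef F i k x y * u 0 k.

(* The flag curvature K(P, y) of the flag P = span{y, u}. *)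
Definition flag_curvature (R : realType) (n : nat)
    (F : 'rV[R]_n -> 'rV[R]_n -> R) (x y u : 'rV[R]_n) : R :=
  fundamental_form F x y u (riemann_curvature F x y u) /
  (fundamental_form F x y y y * fundamental_form F x y u u
   - fundamental_form F x y y u ^+ 2).

Record is_finsler (R : realType) (n : nat) (M : manifold R n)
    (F : tangent_bundle M -> R) : Prop := IsFinsler {
  finsler_ge0 : forall v, 0 <= F v;
  finsler_smooth : forall c, atlas c ->
    smooth_on [set z : 'rV[R]_n * 'rV[R]_n | chart_cod c z.1 /\ z.2 != 0]
      (fun z => local_expr F c z.1 z.2);
  finsler_homogeneous : forall c x y (t : R), atlas c -> chart_cod c x ->
    0 < t -> local_expr F c x (t *: y) = t * local_expr F c x y;
  finsler_posdef : forall c x y u, atlas c -> chart_cod c x ->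
    y != 0 -> u != 0 -> 0 < fundamental_form (local_expr F c) x y u u
}.

Definition is_riemannian (R : realType) (n : nat) (M : manifold R n)
    (F : tangent_bundle M -> R) : Prop :=
  forall c x, atlas c -> chart_cod c x ->
  exists A : 'M[R]_n,
    [/\ A^T = A,
        forall y : 'rV[R]_n, y != 0 -> 0 < (y *m A *m y^T) 0 0 &
        forall y : 'rV[R]_n, local_expr F c x y ^+ 2 = (y *m A *m y^T) 0 0].

Definition positive_flag_curvature (R : realType) (n : nat) (M : manifold R n)
    (F : tangent_bundle M -> R) : Prop :=
  forall c x, atlas c -> chart_cod c x ->
  forall (P : {vspace 'rV[R]_n}) (y u : 'rV[R]_n),
    \dim P = 2%N -> y != 0 -> (<<[:: y; u]>> = P)%VS ->
    0 < flag_curvature (local_expr F c) x y u.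

Definition isotropic_berwald (R : realType) (n : nat) (M : manifold R n)
    (F : tangent_bundle M -> R) (k : R) : Prop :=
  forall c x, atlas c -> chart_cod c x ->
  forall y u v w : 'rV[R]_n, y != 0 ->
    let f := local_expr F c in
    let h := angular_form f x y in
    let B := angular_proj f x y in
    berwald_curvature f x y u v w =
    (k * (f x y)^-1) *:
      (h u v *: B w + h v w *: B u + h w u *: B v
       + (2 * f x y * cartan_torsion f x y u v w) *: unit_vec f x y).

(* Main.v *)
(** The hypotheses are contradictory as soon as [M] has a point.  The
    isotropic Berwald equation says that the third vertical derivatives of
    [G^i - c F y^i] vanish; so this 2-homogeneous function of [y] is quadratic,
    hence even.  Put [P (x, y) = F (x, - y)] and let [H_j] be the horizontal
    derivatives of the spray of [F].  Then [H_j F = 0], and evenness gives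
    [H_j P = - c d/dy^j (F P + P^2)].  Commuting the spray with [H_j] yields
    [R^k_j v_k = - c^2 F^2 v_j] for [v_k = F^2 d/dy^k (P / F)].  Where [v] is
    not [0], the flag spanned by [y] and the [g_y]-dual of [v] has curvature
    [- c^2 < 0].  If [v] vanishes everywhere, [P / F] is constant on each
    (connected) slit tangent space, so [P = F], and then the spray derivative
    of [P] is both [0] and [- 2 c (F P + P^2)], which is nonzero. *)

Require Import Defs.
From mathcomp Require Import all_boot all_order all_algebra.
From mathcomp Require Import all_classical all_reals all_analysis.
From mathcomp Require Import ring lra.
Import Order.TTheory GRing.Theory Num.Theory.
Import numFieldNormedType.Exports.
Local Open Scope classical_set_scope.
Local Open Scope ring_scope.
Set Implicit Arguments.
Unset Strict Implicit.
Unset Printing Implicit Defensive.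


(** * Calculus of C^k functions *)

(** The curvature equation is used on the diagonal u = v = w. Writing F_w for the derivative of F
    along a constant vertical direction w, its right side becomes c (3 F_ww w + F_www y), the third
    derivative of c F y; this is where G^i - c F y^i comes from. Its evenness compares G at - y with
    G at y, although F itself is homogeneous for positive factors only. Differentiating this
    comparison in y and reading H_j F = 0 at - y yields H_j P. The zero vector is the obstacle:
    nothing is smooth there, so polynomial behaviour is established only on lines of T_xM that miss
    0. Dimension at least 2 provides such lines, and they also join y to - y at the end. The value -
    c^2 appears because P / F is homogeneous of degree 0: v annihilates y, its dual u is
    g_y-orthogonal to y, and g_y (u, R_y u) = v_k R^k_j u^j = - c^2 F^2 g_y (u, u), to be divided by
    F^2 g_y (u, u). *)

Section CkCalculus.
Variables (R : realType) (V : normedModType R) (U : set V).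
Hypothesis Uo : open U.
Implicit Types (f g : V -> R) (v w z : V).

Lemma open_near z : U z -> \forall x \near z, U x.
Proof. by move=> Uz; apply: open_nbhs_nbhs. Qed.

Lemma near_eq_in f g z : U z -> (forall x, U x -> f x = g x) ->
  {near z, f =1 g}.
Proof. by move=> /open_near Uz fg; apply: filterS Uz => x /fg. Qed.

Lemma eq_in_derive f g v z : U z -> (forall x, U x -> f x = g x) ->
  'D_v f z = 'D_v g z.
Proof. by move=> Uz fg; apply: near_eq_derive; exact: near_eq_in. Qed.

(** The difference [g - f] vanishes near [z], so it is differentiable there with derivative 0. *)
Lemma near_eq_differentiable f g z : {near z, f =1 g} ->
  differentiable f z -> differentiable g z.
Proof.
move=> fg df.
have -> : g = f + (g - f) by rewrite addrC subrK.
apply: differentiableD => //; set e := g - f.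
have e0 : \forall x \near z, e x = 0.
  by apply: filterS fg => x; rewrite /e !fctE => ->; rewrite subrr.
have E : e \o shift z = cst (e z) + (\0 : {linear V -> R}) +o_ 0 id.
  apply/eqaddoP => _ /posnumP[r] /=.
  rewrite (nbhs_singleton e0).
  have : \forall x \near (0 : V), e (x + z) = 0.
    by move: e0; rewrite (near_shift 0) subr0.
  apply: filterS => x ex.
  by rewrite -[X in `|X|]/(e (x + z) - (0 + 0)) ex addr0 subrr normr0 mulr_ge0.
have c0 : continuous (\0 : {linear V -> R}) by apply: cst_continuous.
by apply/diff_locallyP; rewrite (diff_unique c0 E).
Qed.

(** Allows the derivative of a sum, product or inverse to be replaced by its expanded formula, on
    which the inductions on [k] operate. *)
Lemma Ck_eq_in k f g : (forall x, U x -> f x = g x) -> Ck k U f -> Ck k U g.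
Proof.
elim: k f g => [|k IH] f g fg /=.
  move=> cf x Ux; rewrite /prop_for /continuous_at -(fg _ Ux).
  by apply: cvg_trans (cf x Ux); apply: near_eq_cvg; exact: near_eq_in.
move=> [df Df]; split=> [x Ux|v].
  by apply: near_eq_differentiable (df x Ux); exact: near_eq_in.
by apply: IH (Df v) => x Ux; exact: eq_in_derive.
Qed.

Lemma Ck_le k f : Ck k.+1 U f -> Ck k U f.
Proof.
elim: k f => [|k IH] f /= [df Df].
  by move=> x Ux; exact/differentiable_continuous/df.
by split=> // v; apply: IH; exact: Df.
Qed.

Lemma CkD k f g : Ck k U f -> Ck k U g -> Ck k U (fun z => f z + g z).
Proof.
elim: k f g => [|k IH] f g /=.
  by move=> cf cg x Ux; apply: continuousD; [exact: cf|exact: cg].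
move=> [df Df] [dg Dg]; split=> [x Ux|v].
  by apply: differentiableD; [exact: df|exact: dg].
apply: (Ck_eq_in _ (IH _ _ (Df v) (Dg v))) => x Ux.
by rewrite -deriveD //; apply: diff_derivable; [exact: df|exact: dg].
Qed.

Lemma Ck_cst k (a : R) : Ck k U (fun=> a).
Proof.
elim: k a => [|k IH] a /=; first by move=> x _; exact: cst_continuous.
split=> [x _|v]; first exact: differentiable_cst.
by apply: (Ck_eq_in _ (IH 0)) => x _; rewrite derive_cst.
Qed.

Lemma CkM k f g : Ck k U f -> Ck k U g -> Ck k U (fun z => f z * g z).
Proof.
elim: k f g => [|k IH] f g.
  by move=> cf cg x Ux; apply: (@continuousM R V f g); [exact: cf|exact: cg].
move=> sf sg; have [df Df] := sf; have [dg Dg] := sg; split=> [x Ux|v].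
  by apply: (@differentiableM R V f g); [exact: df|exact: dg].
have Cfg := CkD (IH _ _ (Ck_le sf) (Dg v)) (IH _ _ (Ck_le sg) (Df v)).
apply: (Ck_eq_in _ Cfg) => x Ux; rewrite -(@deriveM R V f g) //.
  exact/diff_derivable/df.
exact/diff_derivable/dg.
Qed.

(** Induction on [k]: the derivative - f^-2 D_v f involves the inverse only at the previous
    order. *)
Lemma CkV k f : (forall z, U z -> f z != 0) -> Ck k U f ->
  Ck k U (fun z => (f z)^-1).
Proof.
move=> f0; elim: k => [|k IH].
  by move=> cf x Ux; apply: continuousV; [exact: f0|exact: cf].
move=> sf; have [df Df] := sf; split=> [x Ux|v].
  by apply: differentiableV; [exact: df|exact: f0].
have Ci := IH (Ck_le sf).
apply: (Ck_eq_in _ (CkM (CkM (Ck_cst k (-1)) (CkM Ci Ci)) (Df v))).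
move=> x Ux; rewrite deriveV ?f0 //; last exact/diff_derivable/df.
by rewrite -exprVn expr2 mulN1r.
Qed.

End CkCalculus.

(** * Derivatives along lines and symmetry of second derivatives *)

Section Lines.
Variables (R : realType) (V : normedModType R).
Implicit Types (f g : V -> R) (v w z : V).

Lemma is_derive_line f z v (s : R) : derivable f (z + s *: v) v ->
  is_derive s 1 (fun t : R => f (z + t *: v)) ('D_v f (z + s *: v)).
Proof.
move=> df.
have E : (fun h : R => h^-1 *:
    (((fun t : R => f (z + t *: v)) \o shift s) (h *: 1) - f (z + s *: v))) =
  (fun h : R => h^-1 *: ((f \o shift (z + s *: v)) (h *: v) - f (z + s *: v))).
  by apply/funext => h /=; rewrite [h *: 1]mulr1 scalerDl addrCA.
by apply: DeriveDef; rewrite /derivable /derive E.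
Qed.

Lemma MVT_line f z v (t : R) : 0 < t ->
  (forall s, 0 <= s <= t -> derivable f (z + s *: v) v) ->
  exists2 s, 0 <= s <= t & f (z + t *: v) - f z = t * 'D_v f (z + s *: v).
Proof.
move=> t0 df.
have [|||s] := @MVT_segment R (fun t : R => f (z + t *: v))
   (fun s => 'D_v f (z + s *: v)) 0 t.
- exact: ltW.
- by move=> s /itvP ss; apply: is_derive_line; apply: df; rewrite !ss.
- apply: derivable_within_continuous => s; rewrite in_itv /= => ss.
  by have [] := is_derive_line (df s ss).
rewrite in_itv /= => ss; rewrite scale0r addr0 subr0 => ->.
by exists s => //; rewrite mulrC.
Qed.

(** The mean value theorem is used twice: for the increment of [f] by [t *: w], along [v], and then
    for ['D_v f] along [w]. The left side is symmetric in [v] and [w]. *)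
Lemma second_difference f (U : set V) z v w (e t : R) : Ck 2 U f ->
  (forall x, `|x| < e -> U (z + x)) -> 0 < t -> t * (`|v| + `|w|) < e ->
  exists2 x, `|x| < e &
  f (z + t *: v + t *: w) - f (z + t *: v) - f (z + t *: w) + f z =
  t ^+ 2 * 'D_w (fun y => 'D_v f y) (z + x).
Proof.
move=> [df Df] Uz t0 te.
have small (a b : R) : 0 <= a <= t -> 0 <= b <= t -> `|a *: v + b *: w| < e.
  move=> /andP[a0 at_] /andP[b0 bt].
  apply: le_lt_trans te; apply: le_trans (ler_normD _ _) _.
  by rewrite !normrZ !ger0_norm // mulrDr lerD // ler_wpM2r.
have tt : 0 <= t <= t by rewrite lexx ltW.
have zz : 0 <= (0 : R) <= t by rewrite lexx ltW.
pose g x := f (x + t *: w) - f x.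
have dft x : U (x + t *: w) -> derivable (fun x => f (x + t *: w)) x v /\
  'D_v (fun x => f (x + t *: w)) x = 'D_v f (x + t *: w).
  move=> Ux; have /(@diff_derivable _ _ _ _ _ v) d := df _ Ux.
  suff E : (fun h : R => h^-1 *:
      (((fun x => f (x + t *: w)) \o shift x) (h *: v) - f (x + t *: w))) =
    (fun h : R => h^-1 *: ((f \o shift (x + t *: w)) (h *: v) - f (x + t *: w))).
    by rewrite /derivable /derive E.
  by apply/funext => h /=; rewrite addrA.
have U1 s : 0 <= s <= t -> U (z + s *: v + t *: w).
  by move=> st; rewrite -addrA; apply: Uz; exact: small.
have U0 s : 0 <= s <= t -> U (z + s *: v).
  by move=> st; apply: Uz; have := small s 0 st zz; rewrite scale0r addr0.
have d0 s : 0 <= s <= t -> derivable f (z + s *: v) v.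
  by move=> /U0 /df; exact: diff_derivable.
have [|s st] := @MVT_line g z v t t0.
  by move=> s st; apply: derivableB; [case: (dft _ (U1 s st))|exact: d0].
have [|r rt Er] := @MVT_line (fun y => 'D_v f y) (z + s *: v) w t t0.
  move=> r rt; apply/diff_derivable/(Df v).1; rewrite -addrA.
  by apply: Uz; exact: small.
have [d1 D1] := dft _ (U1 s st).
rewrite (deriveB d1 (d0 _ st)) D1.
rewrite Er => Eg; exists (s *: v + r *: w); first exact: small.
by rewrite addrA expr2 -mulrA -Eg /g; ring.
Qed.

(** Schwarz's theorem: one and the same second difference, divided by t^2, is a value near [z] of
    each mixed derivative, and both are continuous at [z]. *)
Lemma derive_comm f (U : set V) z v w : open U -> Ck 2 U f -> U z ->
  'D_v (fun x => 'D_w f x) z = 'D_w (fun x => 'D_v f x) z.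
Proof.
move=> Uo sf Uz.
have [C12 C21] : {for z, continuous (fun y => 'D_v (fun x => 'D_w f x) y)} /\
    {for z, continuous (fun y => 'D_w (fun x => 'D_v f x) y)}.
  by split; [apply: (sf.2 w).2|apply: (sf.2 v).2].
apply/eqP; rewrite -subr_eq0 -normr_le0; apply/ler_addgt0Pl => _/posnumP[e].
rewrite addr0.
have N1 : nbhs z U by exact: open_near.
have e2 : 0 < e%:num / 2 by [].
have N2 : \forall x \near z,
    `|'D_v (fun x => 'D_w f x) z - 'D_v (fun x => 'D_w f x) x| < e%:num / 2.
  by apply: (@cvgr_dist_lt _ _ _ _ _ _ _ C12 _ e2).
have N3 : \forall x \near z,
    `|'D_w (fun x => 'D_v f x) z - 'D_w (fun x => 'D_v f x) x| < e%:num / 2.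
  by apply: (@cvgr_dist_lt _ _ _ _ _ _ _ C21 _ e2).
have [d /= d0 near_d] := (nbhs_normP _ _).1 (filterI N1 (filterI N2 N3)).
have in_d x : `|x| < d -> ball_ Num.Def.normr z d (z + x).
  by rewrite /ball_ /= opprD addNKr normrN.
have Ud x : `|x| < d -> U (z + x).
  by move=> /in_d /near_d[].
have [t t0 td] : exists2 t : R, 0 < t & t * (`|v| + `|w|) < d.
  (* The summand 1 keeps the denominator positive when [v] and [w] both vanish. *)
  exists (d / (`|v| + `|w| + 1)); first by rewrite divr_gt0 // ltr_wpDl ?addr_ge0.
  rewrite mulrAC ltr_pdivrMr ?ltr_wpDl ?addr_ge0 //.
  by rewrite ltr_pM2l // ltrDl.
have [p pd] := second_difference sf Ud t0 td.
have td' : t * (`|w| + `|v|) < d by rewrite addrC.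
have [q qd] := second_difference sf Ud t0 td'.
have [_ [_ +]] := near_d _ (in_d _ pd); have [_ [+ _]] := near_d _ (in_d _ qd).
move: ('D_v _ _) ('D_w _ _) ('D_v _ z) ('D_w _ z) => Q P a b Qa Pb EQ EP.
have t2 : t ^+ 2 != 0 by rewrite expf_neq0 // lt0r_neq0.
have PQ : P = Q.
  by apply: (mulfI t2); rewrite -EP -EQ [z + t *: w + _]addrAC; ring.
rewrite (_ : a - b = (a - Q) - (b - P)); last by rewrite PQ; ring.
apply: le_trans (ler_normB _ _) _.
by rewrite [e%:num]splitr; apply: lerD; exact: ltW.
Qed.

End Lines.

(** * Differentiation rules for smooth functions and vector fields *)

Section Calculus.
Variables (R : realType) (V : normedModType R) (U : set V).
Hypothesis Uo : open U.
Implicit Types (f g : V -> R) (v w z : V).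

Lemma smooth_eq f g : (forall x, U x -> f x = g x) ->
  smooth_on U f -> smooth_on U g.
Proof. by move=> fg sf k; apply: Ck_eq_in (sf k). Qed.

Lemma smooth_differentiable f z : smooth_on U f -> U z -> differentiable f z.
Proof. by move=> sf; apply: (sf 1).1. Qed.

Lemma smooth_derivable f z v : smooth_on U f -> U z -> derivable f z v.
Proof. by move=> sf Uz; exact/diff_derivable/smooth_differentiable. Qed.

Lemma smooth_derive f v : smooth_on U f -> smooth_on U (fun z => 'D_v f z).
Proof. by move=> sf k; exact: (sf k.+1).2. Qed.

Lemma smooth_cst (a : R) : smooth_on U (fun=> a).
Proof. by move=> k; exact: Ck_cst. Qed.

Lemma smoothD f g : smooth_on U f -> smooth_on U g ->
  smooth_on U (fun z => f z + g z).
Proof. by move=> sf sg k; apply: CkD. Qed.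

Lemma smoothM f g : smooth_on U f -> smooth_on U g ->
  smooth_on U (fun z => f z * g z).
Proof. by move=> sf sg k; apply: CkM. Qed.

Lemma smoothV f : (forall z, U z -> f z != 0) -> smooth_on U f ->
  smooth_on U (fun z => (f z)^-1).
Proof. by move=> f0 sf k; apply: CkV. Qed.

Lemma smoothZ (a : R) f : smooth_on U f -> smooth_on U (fun z => a * f z).
Proof. exact/smoothM/smooth_cst. Qed.

Lemma smoothN f : smooth_on U f -> smooth_on U (fun z => - f z).
Proof. by move=> /(smoothZ (-1)); apply: smooth_eq => x _; rewrite mulN1r. Qed.

Lemma smoothB f g : smooth_on U f -> smooth_on U g ->
  smooth_on U (fun z => f z - g z).
Proof. by move=> sf /smoothN; exact: smoothD. Qed.

Lemma smooth_sum (I : Type) (r : seq I) (P : pred I) (F : I -> V -> R) :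
  (forall i, P i -> smooth_on U (F i)) ->
  smooth_on U (fun z => \sum_(i <- r | P i) F i z).
Proof.
move=> sF; elim: r => [|i r IH].
  by apply: smooth_eq (smooth_cst 0) => x _; rewrite big_nil.
have [Pi|nPi] := boolP (P i).
  by apply: smooth_eq (smoothD (sF i Pi) IH) => x _; rewrite big_cons Pi.
by apply: smooth_eq IH => x _; rewrite big_cons (negPf nPi).
Qed.

Lemma smooth_prod (I : Type) (r : seq I) (P : pred I) (F : I -> V -> R) :
  (forall i, P i -> smooth_on U (F i)) ->
  smooth_on U (fun z => \prod_(i <- r | P i) F i z).
Proof.
move=> sF; elim: r => [|i r IH].
  by apply: smooth_eq (smooth_cst 1) => x _; rewrite big_nil.
have [Pi|nPi] := boolP (P i).
  by apply: smooth_eq (smoothM (sF i Pi) IH) => x _; rewrite big_cons Pi.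
by apply: smooth_eq IH => x _; rewrite big_cons (negPf nPi).
Qed.

Lemma derivefD f g v z : smooth_on U f -> smooth_on U g -> U z ->
  'D_v (fun x => f x + g x) z = 'D_v f z + 'D_v g z.
Proof. by move=> sf sg Uz; apply: deriveD; exact: smooth_derivable. Qed.

Lemma derivefM f g v z : smooth_on U f -> smooth_on U g -> U z ->
  'D_v (fun x => f x * g x) z = 'D_v f z * g z + f z * 'D_v g z.
Proof.
move=> sf sg Uz; have df : derivable f z v by exact: smooth_derivable.
have dg : derivable g z v by exact: smooth_derivable.
by have := deriveM df dg; rewrite addrC [g z *: _]mulrC.
Qed.

Lemma derivefZ (a : R) f v z : smooth_on U f -> U z ->
  'D_v (fun x => a * f x) z = a * 'D_v f z.
Proof.
by move=> sf Uz; rewrite (derivefM _ (smooth_cst a)) // derive_cst mul0r add0r.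
Qed.

Lemma derivefB f g v z : smooth_on U f -> smooth_on U g -> U z ->
  'D_v (fun x => f x - g x) z = 'D_v f z - 'D_v g z.
Proof. by move=> sf sg Uz; apply: deriveB; exact: smooth_derivable. Qed.

Lemma derivef_sum (I : Type) (r : seq I) (F : I -> V -> R) v z :
  (forall i, smooth_on U (F i)) -> U z ->
  'D_v (fun x => \sum_(i <- r) F i x) z = \sum_(i <- r) 'D_v (F i) z.
Proof.
move=> sF Uz; elim: r => [|i r IH].
  rewrite big_nil (_ : (fun _ => _) = cst 0) ?derive_cst //.
  by apply/funext => x; rewrite big_nil.
rewrite big_cons -IH -derivefD //; last exact: smooth_sum.
by congr ('D_v _ z); apply/funext => x; rewrite big_cons.
Qed.

Lemma derive_dirZ f (a : R) v z : smooth_on U f -> U z ->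
  'D_(a *: v) f z = a * 'D_v f z.
Proof.
by move=> sf Uz; rewrite !deriveE ?linearZ //; exact: smooth_differentiable.
Qed.

Lemma derive_dir_sum f (I : Type) (r : seq I) (v : I -> V) z :
  smooth_on U f -> U z ->
  'D_(\sum_(i <- r) v i) f z = \sum_(i <- r) 'D_(v i) f z.
Proof.
move=> sf Uz; rewrite deriveE ?linear_sum; last exact: smooth_differentiable.
by apply: eq_bigr => i _; rewrite deriveE //; exact: smooth_differentiable.
Qed.

Lemma smooth_derive_comm f v w z : smooth_on U f -> U z ->
  'D_v (fun x => 'D_w f x) z = 'D_w (fun x => 'D_v f x) z.
Proof. by move=> sf; apply: derive_comm (sf 2). Qed.

Section VectorFields.
Variables (I : finType) (e : I -> V).
Implicit Types (a b : I -> V -> R).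

(** Vector fields are coefficient families over a constant frame [e], so that brackets only
    differentiate coefficients. *)
Definition vfield a f z := \sum_i a i z * 'D_(e i) f z.

Definition smooth_field a := forall i, smooth_on U (a i).

Lemma eq_vfield a f g z : (forall x, U x -> f x = g x) -> U z ->
  vfield a f z = vfield a g z.
Proof.
by move=> fg Uz; apply: eq_bigr => i _; congr (_ * _); apply: (eq_in_derive Uo).
Qed.

Lemma vfieldD a f g z : smooth_on U f -> smooth_on U g -> U z ->
  vfield a (fun x => f x + g x) z = vfield a f z + vfield a g z.
Proof.
move=> sf sg Uz; rewrite -big_split; apply: eq_bigr => i _ /=.
by rewrite derivefD // mulrDr.
Qed.

Lemma vfieldM a f g z : smooth_on U f -> smooth_on U g -> U z ->
  vfield a (fun x => f x * g x) z = vfield a f z * g z + f z * vfield a g z.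
Proof.
move=> sf sg Uz; rewrite mulr_suml mulr_sumr -big_split; apply: eq_bigr => i _ /=.
by rewrite derivefM //; ring.
Qed.

Lemma vfield_cst a (k : R) z : vfield a (fun=> k) z = 0.
Proof. by apply: big1 => i _; rewrite derive_cst mulr0. Qed.

Lemma vfield_sum a (J : Type) (r : seq J) (g : J -> V -> R) z :
  (forall j, smooth_on U (g j)) -> U z ->
  vfield a (fun x => \sum_(j <- r) g j x) z = \sum_(j <- r) vfield a (g j) z.
Proof.
move=> sg Uz; rewrite /vfield exchange_big; apply: eq_bigr => i _ /=.
by rewrite derivef_sum // mulr_sumr.
Qed.

Lemma vfieldZ a (k : R) f z : smooth_on U f -> U z ->
  vfield a (fun x => k * f x) z = k * vfield a f z.
Proof.
move=> sf Uz; rewrite mulr_sumr; apply: eq_bigr => i _ /=.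
by rewrite derivefZ //; ring.
Qed.

(** The second order terms a_i b_j D_i D_j f cancel by symmetry of second derivatives, which leaves
    the Lie bracket. *)
Lemma vfield_comm a b f z : smooth_field a -> smooth_field b ->
  smooth_on U f -> U z ->
  vfield a (vfield b f) z - vfield b (vfield a f) z =
  vfield (fun i x => vfield a (b i) x - vfield b (a i) x) f z.
Proof.
move=> sa sb sf Uz.
have E a' b' : smooth_field a' -> smooth_field b' ->
    vfield a' (vfield b' f) z = vfield (fun i => vfield a' (b' i)) f z +
    \sum_i \sum_j a' i z * b' j z * 'D_(e i) (fun x => 'D_(e j) f x) z.
  move=> sa' sb'; rewrite /vfield.
  under eq_bigr => i _.
    rewrite derivef_sum //; last first.
      by move=> j; apply: smoothM => //; exact: smooth_derive.
    under eq_bigr => j _ do rewrite (derivefM _ (sb' j) (smooth_derive (e j) sf) Uz).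
    rewrite big_split mulrDr /=; over.
  rewrite big_split /=; congr (_ + _).
    under eq_bigr => i _ do rewrite mulr_sumr.
    rewrite exchange_big; apply: eq_bigr => j _.
    by rewrite mulr_suml; apply: eq_bigr => i _; rewrite mulrA.
  apply: eq_bigr => i _; rewrite mulr_sumr; apply: eq_bigr => j _.
  by rewrite mulrA.
rewrite !E //.
have -> : \sum_i \sum_j a i z * b j z * 'D_(e i) (fun x => 'D_(e j) f x) z =
    \sum_i \sum_j b i z * a j z * 'D_(e i) (fun x => 'D_(e j) f x) z.
  rewrite exchange_big; apply: eq_bigr => i _; apply: eq_bigr => j _.
  by rewrite [a j z * _]mulrC smooth_derive_comm.
rewrite opprD addrACA subrr addr0 /vfield -sumrB; apply: eq_bigr => i _.
by rewrite mulrBl.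
Qed.

End VectorFields.
End Calculus.

(** * Functions on the slit tangent space of a chart *)

(** Each integration subtracts the expected polynomial and uses that a function with zero derivative
    is constant. *)
Lemma quadratic_of_derivatives (R : realType) (g g1 g2 : R -> R) :
  (forall s, is_derive s (1 : R) g (g1 s)) -> (forall s, is_derive s (1 : R) g1 (g2 s)) ->
  (forall s, is_derive s (1 : R) g2 0) ->
  exists a b d : R, forall s, g s = a + b * s + d * s ^+ 2.
Proof.
move=> dg dg1 dg2.
have E2 s : g2 s = g2 0 by apply: is_derive_0_is_cst.
have E1 s : g1 s = g1 0 + g2 0 * s.
  suff : g1 s - g2 0 * s = g1 0 - g2 0 * 0 by lra.
  apply: (@is_derive_0_is_cst R (fun s => g1 s - g2 0 * s)) => t.
  by apply: is_derive_eq; rewrite E2 [_%:A]mulr1 subrr.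
exists (g 0), (g1 0), (g2 0 / 2) => s.
suff : g s - g1 0 * s - g2 0 / 2 * s ^+ 2 = g 0 - g1 0 * 0 - g2 0 / 2 * 0 ^+ 2.
  by lra.
apply: (@is_derive_0_is_cst R (fun s => g s - g1 0 * s - g2 0 / 2 * s ^+ 2)) => t.
apply: is_derive_eq; rewrite E1 ![_%:A]mulr1 -[_ *: _]/(_ * _).
by field.
Qed.

Section PhaseSpace.
Variables (R : realType) (n : nat) (O : set 'rV[R]_n).
Hypothesis Oo : open O.
Let V := ('rV[R]_n * 'rV[R]_n)%type.

(** With [O] the codomain of a chart, this is by conversion the set on which [finsler_smooth]
    asserts smoothness. *)
Definition slit : set V := [set z | O z.1 /\ z.2 != 0].

Lemma slit_open : open slit.
Proof.
have O1 : open ((fst : V -> 'rV[R]_n) @^-1` O).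
  by apply: open_comp => // z _; exact: cvg_fst.
have O2 : open ((fun z : V => `|z.2|) @^-1` [set r : R | r != 0]).
  apply: open_comp; last by have := @open_neq R 0.
  move=> z _; apply: (@continuous_comp _ _ _ snd (fun y : 'rV[R]_n => `|y|)).
    exact: cvg_snd.
  exact: norm_continuous.
have := openI O1 O2; congr open.
by apply/seteqP; split => z [Oz z0]; split; move: z0; rewrite /= ?normr_eq0.
Qed.

(** Positive factors serve to state homogeneity; the factor -1 is the reversal of y that defines the
    reverse norm. *)
Definition scale_fiber (t : R) (z : V) : V := (z.1, t *: z.2).

Lemma scale_fiber_slit t z : t != 0 -> slit z -> slit (scale_fiber t z).
Proof. by move=> t0 [Oz z0]; split=> //=; rewrite scaler_eq0 negb_or t0. Qed.

Lemma derive_scale_fiber (f : V -> R) t v z :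
  'D_v (fun x => f (scale_fiber t x)) z =
  'D_(scale_fiber t v) f (scale_fiber t z).
Proof.
rewrite /derive /=.
set q := (X in lim (X @ _)); set q' := (X in _ = lim (X @ _)).
suff -> : q = q' by [].
apply/funext => h; rewrite /q /q' /=; congr (_ *: (f _ - _)).
rewrite /scale_fiber /=; congr pair.
by rewrite scalerDr -[RHS]/(h *: (t *: v.2) + t *: z.2) !scalerA mulrC.
Qed.

Lemma differentiable_scale_fiber t z : differentiable (scale_fiber t) z.
Proof.
apply: differentiable_pair.
  by apply: linear_differentiable => x; exact: cvg_fst.
apply: (@differentiableZ _ _ _ snd).
by apply: linear_differentiable => x; exact: cvg_snd.
Qed.

(** The map is linear, so a directional derivative of the composite is again such a composite, of
    the derivative of [f] in the rescaled direction; hence the induction on [k] must vary [f]. *)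
Lemma smooth_scale_fiber (f : V -> R) t : t != 0 -> smooth_on slit f ->
  smooth_on slit (fun z => f (scale_fiber t z)).
Proof.
move=> t0 sf k; elim: k f sf => [|k IH] f sf.
  move=> z Uz; apply: (@continuous_comp _ _ _ (scale_fiber t) f).
    exact/differentiable_continuous/differentiable_scale_fiber.
  exact: (sf 0) (scale_fiber_slit t0 Uz).
split=> [z Uz|v].
  apply: (@differentiable_comp _ _ _ _ (scale_fiber t) f).
    exact: differentiable_scale_fiber.
  exact: smooth_differentiable sf (scale_fiber_slit t0 Uz).
rewrite (_ : (fun _ => _) = (fun z => 'D_(scale_fiber t v) f (scale_fiber t z))).
  apply: (IH (fun z => 'D_(scale_fiber t v) f z)).
  exact: smooth_derive.
by apply/funext => z; exact: derive_scale_fiber.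
Qed.

(** Turns partial derivatives of curried functions into directional derivatives on the product
    space, to which the calculus above applies. *)
Lemma derive_fst (f : 'rV[R]_n -> 'rV[R]_n -> R) v x y :
  'D_v (fun z => f z y) x = 'D_(v, 0) (fun z : V => f z.1 z.2) (x, y).
Proof.
rewrite /derive /=.
set q := (X in lim (X @ _)); set q' := (X in _ = lim (X @ _)).
suff -> : q = q' by [].
by apply/funext => h; rewrite /q /q' /= scaler0 add0r.
Qed.

Lemma derive_snd (f : 'rV[R]_n -> 'rV[R]_n -> R) v x y :
  'D_v (fun z => f x z) y = 'D_(0, v) (fun z : V => f z.1 z.2) (x, y).
Proof.
rewrite /derive /=.
set q := (X in lim (X @ _)); set q' := (X in _ = lim (X @ _)).
suff -> : q = q' by [].
by apply/funext => h; rewrite /q /q' /= scaler0 add0r.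
Qed.

Definition fcoord (k : 'I_n) (z : V) : R := z.2 0 k.

Lemma differentiable_fcoord k z : differentiable (fcoord k) z.
Proof.
apply: (@differentiable_comp _ _ _ _ snd (fun y : 'rV[R]_n => y 0 k : R)).
  by apply: linear_differentiable => x; exact: cvg_snd.
exact: differentiable_coord.
Qed.

Lemma derive_fcoord k v z : 'D_v (fcoord k) z = v.2 0 k.
Proof.
apply: cvg_lim => //; apply: cvg_near_cst.
apply: filterS (@nbhs_dnbhs_neq R 0) => h h0.
by rewrite /fcoord /= !mxE addrK; apply: mulKf.
Qed.

Lemma smooth_fcoord k : smooth_on slit (fcoord k).
Proof.
case=> [|m].
  by move=> z _; exact/differentiable_continuous/differentiable_fcoord.
split=> [z _|v]; first exact: differentiable_fcoord.
have := Ck_cst slit_open m (v.2 0 k); apply: (Ck_eq_in slit_open) => z _.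
by rewrite derive_fcoord.
Qed.

End PhaseSpace.

(** * Functions positively homogeneous in y *)

Section Homogeneity.
Variables (R : realType) (n : nat) (O : set 'rV[R]_n).
Hypothesis Oo : open O.
Let V := ('rV[R]_n * 'rV[R]_n)%type.
Let U : set V := slit O.
Let Uo : open U := slit_open Oo.

Definition coord_dir (i : 'I_n + 'I_n) : V :=
  match i with
  | inl k => (basis_vec R k, 0)
  | inr k => (0, basis_vec R k)
  end.

Lemma derive_vertical (f : V -> R) (v : 'rV[R]_n) z : smooth_on U f -> U z ->
  'D_(0, v) f z = \sum_k v 0 k * 'D_(coord_dir (inr k)) f z.
Proof.
move=> sf Uz; have -> : (0, v) = \sum_k v 0 k *: coord_dir (inr k) :> V.
  rewrite [RHS]surjective_pairing !raddf_sum /=; congr pair.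
    by rewrite big1 // => k _; exact: scaler0.
  exact: row_sum_delta.
rewrite (derive_dir_sum _ _ sf Uz); apply: eq_bigr => k _.
by rewrite (derive_dirZ _ _ sf Uz).
Qed.

Definition fiber_homog (p : nat) (f : V -> R) :=
  forall z t, U z -> 0 < t -> f (scale_fiber t z) = t ^+ p * f z.

Lemma fiber_homog_vertical p f v : smooth_on U f -> fiber_homog p.+1 f ->
  fiber_homog p (fun z => 'D_(0, v) f z).
Proof.
move=> sf hf z t Uz t0; have Utz : U (scale_fiber t z).
  by apply: scale_fiber_slit => //; exact: lt0r_neq0.
have := eq_in_derive Uo (0, v) Uz (fun x Ux => hf x t Ux t0).
have Ev : scale_fiber t (0, v) = t *: ((0, v) : V).
  by congr pair; rewrite scaler0.
rewrite derive_scale_fiber (derivefZ Uo _ _ sf Uz) Ev (derive_dirZ _ _ sf Utz) exprS -mulrA.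
by move/(mulfI (lt0r_neq0 t0)).
Qed.

Lemma fiber_homog_horizontal p f v : smooth_on U f -> fiber_homog p f ->
  fiber_homog p (fun z => 'D_(v, 0) f z).
Proof.
move=> sf hf z t Uz t0.
have Ev : scale_fiber t (v, 0) = (v, 0) :> V by congr pair; exact: scaler0.
have := eq_in_derive Uo (v, 0) Uz (fun x Ux => hf x t Ux t0).
by rewrite derive_scale_fiber (derivefZ Uo _ _ sf Uz) Ev.
Qed.

Lemma fiber_homogM p q f g : fiber_homog p f -> fiber_homog q g ->
  fiber_homog (p + q) (fun z => f z * g z).
Proof. by move=> hf hg z t Uz t0; rewrite hf // hg // exprD; ring. Qed.

(** Both sides are the derivative at t = 0 of f (x, (1 + t) y), which equals (1 + t)^p f (x, y) as
    long as 1 + t > 0. *)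
Lemma euler p f z : smooth_on U f -> fiber_homog p f -> U z ->
  'D_(0, z.2) f z = p%:R * f z.
Proof.
move=> sf hf Uz.
have df : derivable f (z + 0 *: ((0, z.2) : V)) (0, z.2).
  by rewrite scale0r addr0; exact: smooth_derivable sf Uz.
have [_] := is_derive_line df; rewrite scale0r addr0 => <-.
have E : \forall t \near (0 : R), f (z + t *: ((0, z.2) : V)) = (1 + t) ^+ p * f z.
  near=> t; have t1 : 0 < 1 + t.
    by rewrite -ltrBlDl sub0r; near: t; apply: lt_nbhsr; rewrite ltrN10.
  rewrite -hf //; congr f; rewrite /scale_fiber scalerDl scale1r.
  by rewrite -[LHS]/(z.1 + t *: 0, _) scaler0 addr0.
rewrite (near_eq_derive _ E).
have h : is_derive (0 : R) 1 (fun t : R => (1 + t) ^+ p * f z) (p%:R * f z).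
  case: p {hf E} => [|p].
    rewrite (_ : (fun _ => _) = cst (f z)) ?mul0r; last first.
      by apply/funext => t; rewrite expr0 mul1r.
    exact: is_derive_cst.
  rewrite (_ : (fun _ => _) = (cst 1 + id) ^+ p.+1 * cst (f z)); last first.
    by apply/funext => t; rewrite !fctE.
  apply: is_derive_eq; rewrite !fctE /= addr0 !expr1n mulr1 scaler0 !add0r.
  by rewrite [_%:A]mulr1; exact: mulrC.
by have [_] := h.
Unshelve. all: by end_near. Qed.

Lemma euler_sum p f z : smooth_on U f -> fiber_homog p f -> U z ->
  \sum_k z.2 0 k * 'D_(coord_dir (inr k)) f z = p%:R * f z.
Proof. by move=> sf hf Uz; rewrite -derive_vertical // (euler sf hf Uz). Qed.

End Homogeneity.

Section Coordinates.
Variables (R : realType) (n : nat) (f : 'rV[R]_n -> 'rV[R]_n -> R).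

Lemma dxE k z : dx k f z.1 z.2 =
  'D_(@coord_dir R n (inl k)) (fun x => f x.1 x.2) z.
Proof. by rewrite /dx (derive_fst f) -surjective_pairing. Qed.

Lemma dyE k z : dy k f z.1 z.2 =
  'D_(@coord_dir R n (inr k)) (fun x => f x.1 x.2) z.
Proof. by rewrite /dy (derive_snd f) -surjective_pairing. Qed.

End Coordinates.

Section ThirdDerivative.
Variables (R : realType) (n : nat) (O : set 'rV[R]_n).
Hypothesis Oo : open O.
Let V := ('rV[R]_n * 'rV[R]_n)%type.
Let U : set V := slit O.
Let Uo : open U := slit_open Oo.
Local Notation dY k := (@coord_dir R n (inr k)).

(** Expands a thrice repeated derivative into the coordinate sums in which [berwald_curvature] is
    written. *)
Lemma derive3_vertical (w : 'rV[R]_n) (g : V -> R) z : smooth_on U g -> U z ->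
  'D_(0, w) (fun x => 'D_(0, w) (fun y => 'D_(0, w) g y) x) z =
  \sum_j \sum_k \sum_l
    'D_(dY j) (fun x => 'D_(dY k) (fun y => 'D_(dY l) g y) x) z *
    w 0 j * w 0 k * w 0 l.
Proof.
move=> s0 Uz.
have s1 : smooth_on U (fun y => 'D_(0, w) g y) by exact: smooth_derive.
have s2 : smooth_on U (fun x => 'D_(0, w) (fun y => 'D_(0, w) g y) x).
  exact: smooth_derive.
have sYY k l : smooth_on U (fun x => 'D_(dY k) (fun y => 'D_(dY l) g y) x).
  by do 2!apply: smooth_derive.
have E0 y : U y -> 'D_(0, w) g y = \sum_l w 0 l * 'D_(dY l) g y.
  exact: derive_vertical.
have sl l : smooth_on U (fun y => w 0 l * 'D_(dY l) g y).
  exact: (smoothZ Uo _ (smooth_derive _ s0)).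
have E1 x : U x -> 'D_(0, w) (fun y => 'D_(0, w) g y) x =
    \sum_k \sum_l w 0 k * w 0 l * 'D_(dY k) (fun y => 'D_(dY l) g y) x.
  move=> Ux; apply: (etrans (derive_vertical w s1 Ux)); apply: eq_bigr => k _.
  have E2 : 'D_(dY k) (fun y => 'D_(0, w) g y) x =
      \sum_l w 0 l * 'D_(dY k) (fun y => 'D_(dY l) g y) x.
    apply: (etrans (eq_in_derive Uo _ Ux E0)).
    apply: (etrans (derivef_sum Uo _ _ sl Ux)); apply: eq_bigr => l _.
    exact: (derivefZ Uo _ _ (smooth_derive _ s0) Ux).
  apply: (etrans (congr1 ( *%R (w 0 k)) E2)); rewrite mulr_sumr.
  by apply: eq_bigr => l _; rewrite mulrA.
have skl k l : smooth_on U (fun x => w 0 k * w 0 l *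
    'D_(dY k) (fun y => 'D_(dY l) g y) x) := smoothZ Uo _ (sYY k l).
have sk k : smooth_on U (fun x => \sum_l w 0 k * w 0 l *
    'D_(dY k) (fun y => 'D_(dY l) g y) x).
  by apply: (smooth_sum Uo) => l _; exact: skl.
apply: (etrans (derive_vertical w s2 Uz)); apply: eq_bigr => j _.
have E2 : 'D_(dY j) (fun x => 'D_(0, w) (fun y => 'D_(0, w) g y) x) z =
    \sum_k \sum_l w 0 k * w 0 l *
      'D_(dY j) (fun x => 'D_(dY k) (fun y => 'D_(dY l) g y) x) z.
  apply: (etrans (eq_in_derive Uo _ Uz E1)).
  apply: (etrans (derivef_sum Uo _ _ sk Uz)); apply: eq_bigr => k _.
  apply: (etrans (derivef_sum Uo _ _ (skl k) Uz)); apply: eq_bigr => l _.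
  exact: (derivefZ Uo _ _ (sYY k l) Uz).
apply: (etrans (congr1 ( *%R (w 0 j)) E2)); rewrite mulr_sumr.
apply: eq_bigr => k _; rewrite mulr_sumr; apply: eq_bigr => l _.
by move: ('D_(dY j) _ z) (w 0 j) (w 0 k) (w 0 l) => *; ring.
Qed.

End ThirdDerivative.

(** Supplies lines in a tangent space, and later a broken path from y to - y, that avoid the zero
    vector. *)
Lemma noncollinear (R : realType) (n : nat) (y : 'rV[R]_n) :
  (2 <= n)%N -> y != 0 -> exists w : 'rV[R]_n,
  forall s t : R, s *: y + t *: w = 0 -> s = 0 /\ t = 0.
Proof.
move=> n2 /rV0Pn[i yi].
have [j ji] : exists j : 'I_n, j != i.
  (* Read as [1 < n], [n2] gives the index 1, and [ltnW n2] gives the index 0; one of the two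
     differs from [i]. *)
  have [i0|i0] := eqVneq (i : nat) 0%N.
    by exists (Ordinal n2); rewrite -val_eqE /= i0.
  by exists (Ordinal (ltnW n2)); rewrite -val_eqE /= eq_sym.
exists (basis_vec R j) => s t /rowP E.
have := E i; rewrite !mxE eqxx /= (negPf (_ : i != j)) 1?eq_sym // mulr0 addr0.
move=> /eqP; rewrite mulf_eq0 (negPf yi) orbF => /eqP s0; split=> //.
by have := E j; rewrite !mxE !eqxx s0 mul0r add0r mulr1.
Qed.

(** * Evenness of 2-homogeneous functions with vanishing third derivatives *)

Section Evenness.
Variables (R : realType) (n : nat) (O : set 'rV[R]_n).
Hypothesis Oo : open O.
Let V := ('rV[R]_n * 'rV[R]_n)%type.
Let U : set V := slit O.
Let Uo : open U := slit_open Oo.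

Lemma line_quadratic (q : V -> R) (x a w : 'rV[R]_n) : smooth_on U q ->
  (forall z, U z ->
    'D_(0, w) (fun z1 => 'D_(0, w) (fun z2 => 'D_(0, w) q z2) z1) z = 0) ->
  (forall s : R, U (x, a + s *: w)) ->
  exists b d e : R, forall s, q (x, a + s *: w) = b + d * s + e * s ^+ 2.
Proof.
move=> sq q3 Ul.
have lineE s : (x, a + s *: w) = (x, a) + s *: ((0, w) : V) :> V.
  by rewrite -[RHS]/(x + s *: 0, a + s *: w) scaler0 addr0.
have Ul' s : U ((x, a) + s *: ((0, w) : V)) by rewrite -lineE.
have dl (g : V -> R) (s : R) : smooth_on U g ->
    is_derive s (1 : R) (fun t : R => g ((x, a) + t *: ((0, w) : V)))
      ('D_(0, w) g ((x, a) + s *: ((0, w) : V))).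
  by move=> sg; apply: is_derive_line; exact: smooth_derivable sg (Ul' s).
have s1 : smooth_on U (fun z2 => 'D_(0, w) q z2) by exact: smooth_derive.
have s2 : smooth_on U (fun z1 => 'D_(0, w) (fun z2 => 'D_(0, w) q z2) z1).
  exact: smooth_derive.
pose l (t : R) : V := (x, a) + t *: ((0, w) : V).
have [||s|b [d [e H]]] := quadratic_of_derivatives (g := fun t => q (l t))
  (g1 := fun t => 'D_(0, w) q (l t))
  (g2 := fun t => 'D_(0, w) (fun z2 => 'D_(0, w) q z2) (l t)).
- by move=> s; exact: dl.
- by move=> s; exact: dl.
- by have := dl _ s s2; rewrite q3.
by exists b, d, e => s; rewrite lineE -H.
Qed.

(* For [w] not collinear to [y], [s |-> q (x, w + s *: y)] is a polynomial of
   degree at most 2; by homogeneity its coefficient of degree 2 is [q (x, y)]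
   (as seen for [s > 0]) and [q (x, - y)] (as seen for [s < 0]). *)
Lemma even_of_third_derivative (q : V -> R) z : (2 <= n)%N -> smooth_on U q ->
  fiber_homog O 2 q ->
  (forall w z, U z ->
    'D_(0, w) (fun z1 => 'D_(0, w) (fun z2 => 'D_(0, w) q z2) z1) z = 0) ->
  U z -> q (scale_fiber (-1) z) = q z.
Proof.
move=> n2 sq hq q3 Uz; have [Oz z0] := Uz.
have [w ww] := noncollinear n2 z0.
have Ul s t : (s != 0) || (t != 0) -> U (z.1, s *: z.2 + t *: w).
  move=> st; split=> //=; apply: contraTneq st => /ww[-> ->].
  by rewrite eqxx.
have Up s : U (z.1, w + s *: z.2).
  by rewrite addrC -[w]scale1r; apply: Ul; rewrite oner_eq0 orbT.
have Ur s : U (z.1, z.2 + s *: w).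
  by rewrite -[z.2]scale1r; apply: Ul; rewrite oner_eq0.
have Um s : U (z.1, - z.2 + s *: w).
  by rewrite -scaleN1r; apply: Ul; rewrite oppr_eq0 oner_eq0.
have [p0 [p1 [p2 Ep]]] := line_quadratic sq (q3 z.2) Up.
have [r0 [r1 [r2 Er]]] := line_quadratic sq (q3 w) Ur.
have [m0 [m1 [m2 Em]]] := line_quadratic sq (q3 w) Um.
have -> : q z = r0.
  by have := Er 0; rewrite scale0r addr0 -surjective_pairing => ->; ring.
have -> : q (scale_fiber (-1) z) = m0.
  by have := Em 0; rewrite scale0r addr0 /scale_fiber scaleN1r => ->; ring.
have pr s : 0 < s ->
    p0 + p1 * s + p2 * s ^+ 2 = s ^+ 2 * (r0 + r1 * s^-1 + r2 * s^-1 ^+ 2).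
  move=> s0; rewrite -Ep -Er -(hq _ _ (Ur s^-1) s0); congr q.
  rewrite /scale_fiber /=; congr pair.
  by rewrite scalerDr scalerA divff ?lt0r_neq0 // scale1r addrC.
have pm s : 0 < s ->
    p0 + p1 * - s + p2 * (- s) ^+ 2 = s ^+ 2 * (m0 + m1 * s^-1 + m2 * s^-1 ^+ 2).
  move=> s0; rewrite -Ep -Em -(hq _ _ (Um s^-1) s0); congr q.
  rewrite /scale_fiber /=; congr pair.
  by rewrite scalerDr scalerA divff ?lt0r_neq0 // scale1r addrC scaleNr scalerN.
(* After multiplying out, each of [pr] and [pm] equates two polynomials of degree at most 2 in [s];
   the values 1, 2, 3 identify their coefficients, whence r0 = p2 = m0. *)
have := pr 1 ltr01; have := pr 2 (ltr0n _ 2); have := pr 3 (ltr0n _ 3).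
have := pm 1 ltr01; have := pm 2 (ltr0n _ 2); have := pm 3 (ltr0n _ 3).
rewrite !invr1; lra.
Qed.

End Evenness.

(** * Commutators of the spray and of the horizontal fields *)

Section SprayGeometry.
Variables (R : realType) (n : nat) (O : set 'rV[R]_n).
Hypothesis Oo : open O.
Let V := ('rV[R]_n * 'rV[R]_n)%type.
Let U : set V := slit O.
Let Uo : open U := slit_open Oo.

Variable G : 'I_n -> V -> R.
Hypothesis sG : forall i, smooth_on U (G i).

Local Notation dX k := (@coord_dir R n (inl k)).
Local Notation dY k := (@coord_dir R n (inr k)).

Definition connection (k j : 'I_n) (z : V) : R := 'D_(dY j) (G k) z.

Definition spray_field (i : 'I_n + 'I_n) (z : V) : R :=
  match i with
  | inl k => fcoord k z
  | inr k => - 2 * G k z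
  end.

Definition horizontal_field (j : 'I_n) (i : 'I_n + 'I_n) (z : V) : R :=
  match i with
  | inl k => (k == j)%:R
  | inr k => - connection k j z
  end.

(** The expression of [riemann_coef] for an arbitrary spray [G]; it will be recognised as the
    vertical part of [S, H_j], with S the spray field. *)
Definition spray_riemann (k j : 'I_n) (z : V) : R :=
  2 * 'D_(dX j) (G k) z
  - \sum_l 'D_(dX l) (connection k j) z * fcoord l z
  + 2 * (\sum_l G l z * 'D_(dY l) (connection k j) z)
  - \sum_l connection k l z * connection l j z.

Local Notation spr := (vfield (@coord_dir R n) spray_field).
Local Notation hor j := (vfield (@coord_dir R n) (horizontal_field j)).

Lemma sprE g z : spr g z = \sum_k fcoord k z * 'D_(dX k) g z -
  2 * \sum_k G k z * 'D_(dY k) g z.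
Proof.
rewrite /vfield big_sumType /= mulr_sumr -sumrN; congr (_ + _).
by apply: eq_bigr => k _; ring.
Qed.

Lemma horE j g z : hor j g z =
  'D_(dX j) g z - \sum_k connection k j z * 'D_(dY k) g z.
Proof.
rewrite /vfield big_sumType /= -sumrN; congr (_ + _).
  rewrite (bigD1 j) //= big1 => [|k kj]; first by rewrite eqxx mul1r addr0.
  by rewrite (negPf kj) mul0r.
by apply: eq_bigr => k _; rewrite mulNr.
Qed.

Lemma smooth_connection k j : smooth_on U (connection k j).
Proof. by apply: smooth_derive; exact: sG. Qed.

Lemma smooth_spray_field : smooth_field U spray_field.
Proof.
case=> k; first exact: smooth_fcoord.
by apply: smoothZ => //; exact: sG.
Qed.

Lemma smooth_horizontal_field j : smooth_field U (horizontal_field j).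
Proof.
case=> k; first exact: smooth_cst.
by apply: smoothN => //; exact: smooth_connection.
Qed.

Lemma derive_fcoordX j k z : 'D_(dX j) (@fcoord R n k) z = 0.
Proof. by rewrite derive_fcoord mxE. Qed.

Lemma derive_fcoordY j k z : 'D_(dY j) (@fcoord R n k) z = (k == j)%:R.
Proof. by rewrite derive_fcoord mxE eqxx. Qed.

(** The bracket [d/dy^j, S] is d/dx^j - 2 N^k_j d/dy^k, that is H_j - N^k_j d/dy^k, where N is
    [connection]. *)
Lemma derive_spr j g z : smooth_on U g -> U z ->
  'D_(dY j) (spr g) z = spr (fun x => 'D_(dY j) g x) z + hor j g z -
    \sum_k connection k j z * 'D_(dY k) g z.
Proof.
move=> sg Uz; pose b (i : 'I_n + 'I_n) (z : V) : R := (i == inr j)%:R.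
have bE h x : vfield (@coord_dir R n) b h x = 'D_(dY j) h x.
  rewrite /vfield (bigD1 (inr j)) //= big1 => [|i ij].
    by rewrite /b eqxx mul1r addr0.
  by rewrite /b (negPf ij) mul0r.
have sb : smooth_field U b by move=> i; exact: smooth_cst.
(* The coefficients at [z] of [S, d/dy^j], where d/dy^j is the constant field [b]. *)
pose c (i : 'I_n + 'I_n) : R :=
  match i with inl k => - (k == j)%:R | inr k => 2 * connection k j z end.
have cst0 (a : R) : spr (fun=> a) z = 0.
  by apply: big1 => i _; rewrite derive_cst mulr0.
have cE i : spr (b i) z - vfield (@coord_dir R n) b (spray_field i) z = c i.
  rewrite bE [X in X - _]cst0 sub0r; case: i => k.
    by rewrite [X in - X]derive_fcoordY.
  rewrite [X in - X](derivefZ Uo _ _ (sG k) Uz) /c /connection.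
  by rewrite mulNr opprK.
have comm := vfield_comm Uo (@coord_dir R n) smooth_spray_field sb sg Uz.
rewrite bE (eq_vfield Uo _ _ (fun x _ => bE g x) Uz) in comm.
have E : spr (fun x => 'D_(dY j) g x) z - 'D_(dY j) (spr g) z =
    2 * (\sum_k connection k j z * 'D_(dY k) g z) - 'D_(dX j) g z.
  rewrite comm; transitivity (\sum_i c i * 'D_(@coord_dir R n i) g z).
    by apply: eq_bigr => i _; rewrite cE.
  rewrite big_sumType /= addrC mulr_sumr; congr (_ + _).
    by apply: eq_bigr => k _; rewrite mulrA.
  rewrite (bigD1 j) //= big1 => [|k kj]; last by rewrite (negPf kj) oppr0 mul0r.
  by rewrite eqxx mulN1r addr0.
rewrite horE; move: E; move: ('D_(dY j) _ z) (spr _ z) ('D_(dX j) g z) (\sum_k _).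
by move=> A B C D E; lra.
Qed.

(** The d/dx^k coefficient of [S, H_j] is N^k_j; once the bracket is written in the frame H_k,
    d/dy^k, its vertical coefficients are exactly the Riemann ones. *)
Lemma spray_horizontal_comm j g z : smooth_on U g -> U z ->
  spr (hor j g) z - hor j (spr g) z =
  \sum_k connection k j z * hor k g z + \sum_k spray_riemann k j z * 'D_(dY k) g z.
Proof.
move=> sg Uz.
(* Coefficients of the bracket in the coordinate frame; replacing d/dx^k by H_k + N^l_k d/dy^l
   restores the product of connections subtracted here. *)
pose c (i : 'I_n + 'I_n) : R :=
  match i with
  | inl k => connection k j z
  | inr k => spray_riemann k j z - \sum_l connection k l z * connection l j z
  end.
have cE i : spr (horizontal_field j i) z - hor j (spray_field i) z = c i.
  case: i => k.
    have E0 : spr (fun=> (k == j)%:R) z = 0.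
      by apply: big1 => i _; rewrite derive_cst mulr0.
    have E1 : hor j (fcoord k) z = - connection k j z.
      rewrite horE derive_fcoordX (bigD1 k) //= big1 => [|l lk]; last first.
        by rewrite derive_fcoordY eq_sym (negPf lk) mulr0.
      by rewrite derive_fcoordY eqxx mulr1 addr0 sub0r.
    by rewrite [X in X - _]E0 [X in _ - X]E1 sub0r opprK.
  have -> : spr (horizontal_field j (inr k)) z = - spr (connection k j) z.
    rewrite -mulN1r -(vfieldZ Uo _ _ _ (smooth_connection k j) Uz).
    by apply: (eq_vfield Uo) => // x _; rewrite mulN1r.
  have S1 : \sum_l fcoord l z * 'D_(dX l) (connection k j) z =
      \sum_l 'D_(dX l) (connection k j) z * fcoord l z.
    by apply: eq_bigr => l _; rewrite mulrC.
  have S2 : \sum_l connection l j z * 'D_(dY l) (G k) z =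
      \sum_l connection k l z * connection l j z.
    by apply: eq_bigr => l _; rewrite mulrC.
  have E1 := etrans (sprE (connection k j) z) (congr1 (fun r => r - _) S1).
  have E2 := etrans (horE j (G k) z) (congr1 (fun r => _ - r) S2).
  rewrite [X in _ - X](vfieldZ Uo _ _ _ (sG k) Uz) E1 E2 /c /spray_riemann.
  by ring.
rewrite (vfield_comm Uo _ smooth_spray_field (smooth_horizontal_field j) sg Uz).
transitivity (\sum_i c i * 'D_(@coord_dir R n i) g z).
  by apply: eq_bigr => i _; rewrite cE.
rewrite big_sumType /=.
under [X in _ + X = _]eq_bigr => k _ do rewrite mulrBl mulr_suml.
rewrite sumrB.
under [X in _ = X + _]eq_bigr => k _ do rewrite horE mulrBr.
rewrite sumrB exchange_big /=.
under [X in _ = _ - X + _]eq_bigr => k _ do rewrite mulr_sumr.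
have -> : \sum_l \sum_k connection k l z * connection l j z * 'D_(dY k) g z =
  \sum_l \sum_k connection l j z * (connection k l z * 'D_(dY k) g z).
  by apply: eq_bigr => l _; apply: eq_bigr => k _; ring.
by rewrite addrA addrAC.
Qed.

End SprayGeometry.

(** * Invariance of the norm and curvature of the reverse norm *)

Section FinslerSpray.
Variables (R : realType) (n : nat) (O : set 'rV[R]_n).
Hypothesis Oo : open O.
Let V := ('rV[R]_n * 'rV[R]_n)%type.
Let U : set V := slit O.
Let Uo : open U := slit_open Oo.

Variable G : 'I_n -> V -> R.
Hypothesis sG : forall i, smooth_on U (G i).
Hypothesis hG : forall i, fiber_homog O 2 (G i).

Local Notation dX k := (@coord_dir R n (inl k)).
Local Notation dY k := (@coord_dir R n (inr k)).
Local Notation spr := (vfield (@coord_dir R n) (spray_field G)).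
Local Notation hor j := (vfield (@coord_dir R n) (horizontal_field G j)).
Local Notation N := (connection G).

Lemma eq_spr g h z : (forall x, U x -> g x = h x) -> U z -> spr g z = spr h z.
Proof. exact: (eq_vfield Uo). Qed.

Lemma eq_hor j g h z : (forall x, U x -> g x = h x) -> U z -> hor j g z = hor j h z.
Proof. exact: (eq_vfield Uo). Qed.

Lemma spr_fcoord m z : spr (fcoord m) z = - 2 * G m z.
Proof.
rewrite sprE [X in X - _]big1 => [|k _]; last by rewrite derive_fcoordX mulr0.
rewrite (bigD1 m) //= big1 => [|k km]; last first.
  by rewrite derive_fcoordY eq_sym (negPf km) mulr0.
by rewrite derive_fcoordY eqxx mulr1 addr0 sub0r mulNr.
Qed.

(** Euler's identity gives y^j N^k_j = 2 G^k, so S = y^j H_j. *)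
Lemma spr_hor g z : U z -> spr g z = \sum_j fcoord j z * hor j g z.
Proof.
move=> Uz; under eq_bigr => j _ do rewrite horE mulrBr.
rewrite sumrB sprE; congr (_ - _).
under [RHS]eq_bigr => j _ do rewrite mulr_sumr.
rewrite exchange_big mulr_sumr; apply: eq_bigr => k _ /=.
have := euler_sum (sG k) (hG k) Uz; rewrite mulrA => <-.
by rewrite mulr_suml; apply: eq_bigr => j _; rewrite mulrA.
Qed.

Section Energy.
Variable E : V -> R.
Hypothesis sE : smooth_on U E.
Hypothesis hE : fiber_homog O 2 E.
Hypothesis EL : forall m z, U z ->
  spr (fun x => 'D_(dY m) E x) z = 'D_(dX m) E z.

(** Applying S to y^m dE/dy^m = 2 E and using the Euler-Lagrange equation [EL] gives 2 S E = S E. *)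
Lemma spr_energy0 z : U z -> spr E z = 0.
Proof.
move=> Uz.
have sd m : smooth_on U (fun x => 'D_(dY m) E x) by exact: smooth_derive.
have sp m : smooth_on U (fun x => fcoord m x * 'D_(dY m) E x).
  by apply: smoothM => //; exact: smooth_fcoord.
have E2 : spr (fun x => \sum_m fcoord m x * 'D_(dY m) E x) z = 2 * spr E z.
  rewrite -(vfieldZ Uo _ _ _ sE Uz); apply: eq_spr => // x Ux.
  exact: (euler_sum sE hE Ux).
have E1 : spr (fun x => \sum_m fcoord m x * 'D_(dY m) E x) z = spr E z.
  rewrite (vfield_sum Uo _ _ _ sp Uz) sprE mulr_sumr -sumrB.
  apply: eq_bigr => m _.
  rewrite (vfieldM _ _ (smooth_fcoord Oo m) (sd m) Uz) EL // spr_fcoord.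
  by rewrite mulNr mulNr mulrA addrC.
by move: E1; rewrite E2; lra.
Qed.

(** Differentiating S E = 0 in y^j, [derive_spr] and [EL] leave 2 H_j E = 0. *)
Lemma hor_energy0 j z : U z -> hor j E z = 0.
Proof.
move=> Uz; have := derive_spr Oo sG j sE Uz.
rewrite (eq_in_derive Uo _ Uz spr_energy0) derive_cst EL //.
have := horE G j E z.
move: (hor j E z) ('D_(dX j) E z) (\sum_k _) => a b d; lra.
Qed.

End Energy.

Variables (F : V -> R) (c : R).
Hypothesis sF : smooth_on U F.
Hypothesis hF : fiber_homog O 1 F.
Hypothesis horF : forall j z, U z -> hor j F z = 0.

Let P z := F (scale_fiber (-1) z).
(** The evenness of G^k - c F y^k, solved for G^k at - y. *)
Hypothesis GP : forall k z, U z ->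
  G k (scale_fiber (-1) z) = G k z - c * ((F z + P z) * fcoord k z).

Let N1 : (-1 : R) != 0. Proof. by rewrite oppr_eq0 oner_eq0. Qed.

Lemma smooth_reverse : smooth_on U P.
Proof. exact: smooth_scale_fiber. Qed.

Lemma fiber_homog_reverse : fiber_homog O 1 P.
Proof.
move=> z t Uz t0; rewrite /P -hF //; last exact: scale_fiber_slit.
by congr F; rewrite /scale_fiber /= !scalerA mulrC.
Qed.

Let sP := smooth_reverse.

Lemma derive_reverseX (g : V -> R) j z :
  'D_(dX j) (fun x => g (scale_fiber (-1) x)) z = 'D_(dX j) g (scale_fiber (-1) z).
Proof.
rewrite derive_scale_fiber; congr ('D_(_) g _).
by rewrite /scale_fiber /= scaler0.
Qed.

Lemma derive_reverseY (g : V -> R) j z : smooth_on U g -> U z ->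
  'D_(dY j) (fun x => g (scale_fiber (-1) x)) z = - 'D_(dY j) g (scale_fiber (-1) z).
Proof.
move=> sg Uz; rewrite derive_scale_fiber.
have -> : scale_fiber (-1) (dY j) = (-1) *: dY j.
  by rewrite /scale_fiber /=; congr pair; rewrite scaler0.
by rewrite (derive_dirZ _ _ sg (scale_fiber_slit N1 Uz)) mulN1r.
Qed.

(** H_j F = 0 at - y expresses dP/dx^j through N at - y, which [GP] relates to N at y; Euler's
    identity for P then sums the correction terms. *)
Lemma hor_reverse j z : U z ->
  hor j P z = - c * 'D_(dY j) (fun x => F x * P x + P x * P x) z.
Proof.
move=> Uz; have USz := scale_fiber_slit N1 Uz.
(* The y^j-derivative of the right side of [GP]; that of the left side is - N^k_j at - y. *)
pose S k := N k j z - c * (('D_(dY j) F z + 'D_(dY j) P z) * fcoord k z +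
   (F z + P z) * (k == j)%:R).
have NS k : N k j (scale_fiber (-1) z) = - S k.
  rewrite /S -[LHS]opprK; congr (- _).
  rewrite -(derive_reverseY _ (sG k) Uz).
  rewrite (eq_in_derive Uo _ Uz (GP k)).
  have sFP : smooth_on U (fun x => F x + P x) by exact: smoothD.
  have sy := smooth_fcoord Oo k.
  have sFy := smoothM Uo sFP sy.
  rewrite (derivefB _ (sG k) (smoothZ Uo c sFy) Uz) (derivefZ Uo _ _ sFy Uz).
  by rewrite (derivefM _ sFP sy Uz) (derivefD _ sF sP Uz) derive_fcoordY.
have HF := horF j USz; rewrite horE in HF.
have XP : 'D_(dX j) P z = \sum_k S k * 'D_(dY k) P z.
  rewrite /P derive_reverseX; move/eqP: HF; rewrite subr_eq0 => /eqP ->.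
  apply: eq_bigr => k _; rewrite NS derive_reverseY //.
  by rewrite mulrN mulNr.
rewrite horE XP -sumrB.
have -> : \sum_k (S k * 'D_(dY k) P z - N k j z * 'D_(dY k) P z) =
   \sum_k (- c * ('D_(dY j) F z + 'D_(dY j) P z) * (fcoord k z * 'D_(dY k) P z) +
     (- c * (F z + P z)) * ((k == j)%:R * 'D_(dY k) P z)).
  apply: eq_bigr => k _; rewrite /S.
  by move: (N k j z) ('D_(dY k) P z) ('D_(dY j) F z) ('D_(dY j) P z) => *; ring.
rewrite big_split /= -!mulr_sumr (euler_sum sP fiber_homog_reverse Uz).
rewrite (bigD1 j) //= big1 => [|k kj]; last by rewrite (negPf kj) mul0r.
rewrite eqxx (@derivefD _ _ U) //; try exact: smoothM.
rewrite !(@derivefM _ _ U) // mul1r mul1r addr0.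
by ring.
Qed.

Let W z := F z * P z + P z * P z.

Let sW : smooth_on U W.
Proof. by apply: smoothD => //; exact: smoothM. Qed.

Lemma fiber_homog_W : fiber_homog O 2 W.
Proof.
move=> z t Uz t0; rewrite /W hF // fiber_homog_reverse //.
by rewrite expr1; ring.
Qed.

Lemma spr_reverse z : U z -> spr P z = - 2 * c * W z.
Proof.
move=> Uz; rewrite spr_hor //.
have -> : \sum_j fcoord j z * hor j P z =
    - c * \sum_j fcoord j z * 'D_(dY j) W z.
  rewrite mulr_sumr; apply: eq_bigr => j _.
  by rewrite hor_reverse // mulrCA.
by rewrite (euler_sum sW fiber_homog_W Uz); ring.
Qed.

Lemma spr_norm0 z : U z -> spr F z = 0.
Proof.
move=> Uz; rewrite spr_hor // big1 // => j _.
by rewrite horF // mulr0.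
Qed.

(** The bracket [S, H_j] is applied to F, which S and every H_k annihilate. *)
Lemma riemann_norm j z : U z -> \sum_k spray_riemann G k j z * 'D_(dY k) F z = 0.
Proof.
move=> Uz; have comm := spray_horizontal_comm Oo sG j sF Uz.
have E1 : spr (hor j F) z = 0 := etrans (eq_spr (horF j) Uz) (vfield_cst _ _ _ _).
have E2 : hor j (spr F) z = 0 := etrans (eq_hor j spr_norm0 Uz) (vfield_cst _ _ _ _).
have E3 : \sum_k N k j z * hor k F z = 0.
  by apply: big1 => k _; rewrite horF // mulr0.
have {}comm := etrans (esym (congr2 (fun a b => a - b) E1 E2)) comm.
by have := etrans comm (congr1 (+%R^~ _) E3); rewrite subr0 add0r.
Qed.

(** Applying [S, H_j] to P and eliminating S (dW/dy^j) by [derive_spr] leaves 3 c H_j W - c d(S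
    W)/dy^j. With Q = F + 2 P, H_j W = - c Q dW/dy^j and S W = - 2 c Q W, so this is c^2 (2 W
    dQ/dy^j - Q dW/dy^j), which expands to the right side. *)
Lemma riemann_reverse j z : U z ->
  \sum_k spray_riemann G k j z * 'D_(dY k) P z =
  - c ^+ 2 * F z * (F z * 'D_(dY j) P z - P z * 'D_(dY j) F z).
Proof.
move=> Uz; have comm := spray_horizontal_comm Oo sG j sP Uz.
have sdW i : smooth_on U (fun x => 'D_(dY i) W x) by exact: smooth_derive.
have E1 : spr (hor j P) z = - c * spr (fun x => 'D_(dY j) W x) z.
  rewrite -(vfieldZ Uo _ _ _ (sdW j) Uz); apply: eq_spr => // x Ux.
  exact: hor_reverse.
have E2 : hor j (spr P) z = - 2 * c * hor j W z.
  rewrite -(vfieldZ Uo _ _ _ sW Uz); apply: eq_hor => // x Ux.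
  exact: spr_reverse.
have E3 : \sum_k N k j z * hor k P z = - c * \sum_k N k j z * 'D_(dY k) W z.
  rewrite mulr_sumr; apply: eq_bigr => k _.
  by rewrite hor_reverse // mulrCA.
have vfW a x : U x -> vfield (@coord_dir R n) a W x =
    vfield (@coord_dir R n) a F x * P x +
    (F x + 2 * P x) * vfield (@coord_dir R n) a P x.
  move=> Ux; rewrite (@vfieldD _ _ U); [|exact: smoothM|exact: smoothM|exact: Ux].
  by rewrite !(@vfieldM _ _ U) //; ring.
pose Q x := F x + 2 * P x.
have s2P : smooth_on U (fun x => 2 * P x) by exact: smoothZ.
have sQ : smooth_on U Q by exact: smoothD.
have E4 := derive_spr Oo sG j sW Uz.
have sprW x : U x -> spr W x = - 2 * c * (Q x * W x).
  by move=> Ux; rewrite vfW // spr_norm0 // spr_reverse // /Q; ring.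
have E5 : 'D_(dY j) (spr W) z = - 2 * c * (('D_(dY j) F z + 2 * 'D_(dY j) P z) * W z +
    Q z * 'D_(dY j) W z).
  rewrite (eq_in_derive Uo _ Uz sprW) (derivefZ Uo _ _ (smoothM Uo sQ sW) Uz).
  rewrite (derivefM _ sQ sW Uz) (derivefD _ sF s2P Uz).
  by rewrite (derivefZ Uo _ _ sP Uz).
have E6 : hor j W z = - c * Q z * 'D_(dY j) W z.
  by rewrite vfW // horF // hor_reverse // /Q; ring.
have E7 : 'D_(dY j) W z = 'D_(dY j) F z * P z + F z * 'D_(dY j) P z +
    2 * P z * 'D_(dY j) P z.
  rewrite (@derivefD _ _ U); [|exact: smoothM|exact: smoothM|exact: Uz].
  by rewrite !(@derivefM _ _ U) //; ring.
have {}comm := etrans (esym (congr2 (fun a b => a - b) E1 E2)) comm.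
have {E1 E2 E3}comm := etrans comm (congr1 (+%R^~ _) E3).
have {E5}E4 := etrans (esym E5) E4.
move: comm E4 E6 E7; rewrite /Q /W.
move: (\sum_k spray_riemann _ _ _ _ * _) (hor j _ z) ('D_(dY j) W z).
move: (spr _ z) (\sum_k _) ('D_(dY j) F z) ('D_(dY j) P z) (F z) (P z).
move=> s t a b p q r h w comm E4 E6 E7.
have -> : r = - c * (s - 2 * h - t) by lra.
have -> : s = t - h - 2 * c * ((a + 2 * b) * (p * q + q * q) + (p + 2 * q) * w).
  by rewrite mulrDr; move: E4; rewrite mulrDr; lra.
by rewrite E6 E7; ring.
Qed.

(** F times [riemann_reverse] minus P times [riemann_norm]: the covector F^2 d(P / F) satisfies a
    left eigenvector equation for the Riemann curvature. *)
Lemma riemann_ratio j z : U z ->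
  \sum_k spray_riemann G k j z * (F z * 'D_(dY k) P z - P z * 'D_(dY k) F z) =
  - c ^+ 2 * F z ^+ 2 * (F z * 'D_(dY j) P z - P z * 'D_(dY j) F z).
Proof.
move=> Uz.
under eq_bigr => k _ do rewrite mulrBr mulrCA [X in _ - X]mulrCA.
rewrite sumrB -!mulr_sumr (riemann_norm j Uz) (riemann_reverse j Uz).
by ring.
Qed.

End FinslerSpray.

(** * The spray of a Finsler metric in a chart *)

Section SmoothMatrices.
Variables (R : realType) (V : normedModType R) (U : set V).
Hypothesis Uo : open U.

Lemma smooth_det m (A : V -> 'M[R]_m) :
  (forall i j, smooth_on U (fun z => A z i j)) ->
  smooth_on U (fun z => \det (A z)).
Proof.
move=> sA; rewrite /determinant; apply: smooth_sum => // s _.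
by apply: smoothZ => //; apply: smooth_prod.
Qed.

(** The entries of the inverse are cofactors divided by the determinant. *)
Lemma smooth_invmx m (A : V -> 'M[R]_m) :
  (forall z, U z -> A z \in unitmx) ->
  (forall i j, smooth_on U (fun z => A z i j)) ->
  forall i j, smooth_on U (fun z => invmx (A z) i j).
Proof.
move=> uA sA i j.
have : smooth_on U (fun z => (\det (A z))^-1 * ((-1) ^+ (j + i) *
    \det (row' j (col' i (A z))))).
  apply: smoothM => //.
    apply: smoothV => [//|z Uz|]; last exact: smooth_det.
    by have := uA z Uz; rewrite unitmxE unitfE.
  apply: smoothZ => //; apply: smooth_det => k l.
  have := sA (lift j k) (lift i l).
  by apply: smooth_eq => // z _; rewrite !mxE.
by apply: smooth_eq => // z Uz; rewrite /invmx uA // !mxE.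
Qed.

End SmoothMatrices.

Section LocalFinsler.
Variables (R : realType) (n : nat) (O : set 'rV[R]_n).
Hypothesis Oo : open O.
Let V := ('rV[R]_n * 'rV[R]_n)%type.
Let U : set V := slit O.
Let Uo : open U := slit_open Oo.

Variable f : 'rV[R]_n -> 'rV[R]_n -> R.
Hypothesis sf : smooth_on U (fun z => f z.1 z.2).
Hypothesis hf : forall x y (t : R), O x -> 0 < t -> f x (t *: y) = t * f x y.
Hypothesis pf : forall x y u, O x -> y != 0 -> u != 0 ->
  0 < fundamental_form f x y u u.

Local Notation dX k := (@coord_dir R n (inl k)).
Local Notation dY k := (@coord_dir R n (inr k)).

Definition energy (z : V) : R := f z.1 z.2 * f z.1 z.2.
Definition spray_at (i : 'I_n) (z : V) : R := spray f i z.1 z.2.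
Definition metric_at (z : V) : 'M[R]_n := metric_mx f z.1 z.2.

Lemma fundamental_formE z u v : fundamental_form f z.1 z.2 u v =
  2^-1 * 'D_(0, u) (fun z => 'D_(0, v) energy z) z.
Proof.
have E : (fun x : V => 'D_v (sqf f x.1) x.2) = (fun x => 'D_(0, v) energy x).
  by apply/funext => x; rewrite (derive_snd (sqf f)) -surjective_pairing.
rewrite /fundamental_form (derive_snd (fun x y => 'D_v (sqf f x) y)).
by rewrite -surjective_pairing E.
Qed.

Lemma smooth_energy : smooth_on U energy. Proof. exact: smoothM. Qed.

Lemma fiber_homog_norm : fiber_homog O 1 (fun z => f z.1 z.2).
Proof. by move=> z t [Oz _] t0; rewrite expr1 -hf. Qed.

Lemma fiber_homog_energy : fiber_homog O 2 energy.
Proof. exact: (fiber_homogM fiber_homog_norm fiber_homog_norm). Qed.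

Lemma smooth_denergy v w :
  smooth_on U (fun z => 'D_v (fun x => 'D_w energy x) z).
Proof. by do 2!apply: smooth_derive; exact: smooth_energy. Qed.

Lemma metric_atE i j z :
  metric_at z i j = 2^-1 * 'D_(dY i) (fun x => 'D_(dY j) energy x) z.
Proof. by rewrite mxE fundamental_formE. Qed.

Lemma smooth_metric i j : smooth_on U (fun z => metric_at z i j).
Proof.
have := smoothZ Uo 2^-1 (smooth_denergy (dY i) (dY j)).
by apply: smooth_eq => // z _; rewrite metric_atE.
Qed.

Lemma fundamental_form_sum z u v : U z -> fundamental_form f z.1 z.2 u v =
  \sum_i \sum_j u 0 i * v 0 j * metric_at z i j.
Proof.
move=> Uz; have sE := smooth_energy.
rewrite fundamental_formE (derive_vertical _ (smooth_derive _ sE) Uz).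
rewrite mulr_sumr; apply: eq_bigr => i _.
have -> : 'D_(dY i) (fun z => 'D_(0, v) energy z) z =
    'D_(dY i) (fun z => \sum_j v 0 j * 'D_(dY j) energy z) z.
  by apply: (eq_in_derive Uo) => // x Ux; exact: (derive_vertical _ sE Ux).
rewrite (derivef_sum Uo) //; last first.
  by move=> j; apply: smoothZ => //; exact: smooth_derive.
rewrite !mulr_sumr; apply: eq_bigr => j _.
rewrite metric_atE (derivefZ Uo) //; last exact: smooth_derive.
by ring.
Qed.

Lemma fundamental_form_mx z u v : U z -> fundamental_form f z.1 z.2 u v =
  (u *m metric_at z *m v^T) 0 0.
Proof.
move=> Uz; rewrite fundamental_form_sum // exchange_big !mxE.
apply: eq_bigr => j _; rewrite !mxE mulr_suml; apply: eq_bigr => i _.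
by ring.
Qed.

Lemma fundamental_formC z u v : U z ->
  fundamental_form f z.1 z.2 u v = fundamental_form f z.1 z.2 v u.
Proof.
move=> Uz; rewrite !fundamental_formE.
exact: (congr1 ( *%R 2^-1) (smooth_derive_comm Uo (0, u) (0, v) smooth_energy Uz)).
Qed.

Lemma metric_unit z : U z -> metric_at z \in unitmx.
Proof.
move=> Uz; rewrite unitmxE unitfE; apply/negP => /det0P[u u0 ug].
have [Oz z0] := Uz; have := pf Oz z0 u0.
by rewrite fundamental_form_mx // ug mul0mx mxE ltxx.
Qed.

Definition spray_rhs m z : R :=
  \sum_k 'D_(dX k) (fun x => 'D_(dY m) energy x) z * fcoord k z - 'D_(dX m) energy z.

Lemma spray_atE i z : spray_at i z =
  4^-1 * \sum_m invmx (metric_at z) i m * spray_rhs m z.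
Proof.
have E m : (fun x : V => dy m (sqf f) x.1 x.2) = (fun x => 'D_(dY m) energy x).
  by apply/funext => x; exact: dyE.
have E1 m : dx m (sqf f) z.1 z.2 = 'D_(dX m) energy z by exact: dxE.
have E2 k m : dx k (dy m (sqf f)) z.1 z.2 =
    'D_(dX k) (fun x => 'D_(dY m) energy x) z.
  exact: (etrans (dxE _ _ _) (congr1 (fun g => 'D_(dX k) g z) (E m))).
rewrite /spray_at /spray /spray_rhs /metric_at.
under eq_bigr => m _.
  rewrite E1.
  under eq_bigr => k _ do rewrite E2.
  over.
by [].
Qed.

Lemma smooth_spray_rhs m : smooth_on U (spray_rhs m).
Proof.
apply: smoothB => //; last by apply: smooth_derive; exact: smooth_energy.
apply: smooth_sum => // k _; apply: smoothM => //; last exact: smooth_fcoord.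
exact: smooth_denergy.
Qed.

Lemma smooth_spray i : smooth_on U (spray_at i).
Proof.
have : smooth_on U (fun z => 4^-1 * \sum_m invmx (metric_at z) i m * spray_rhs m z).
  apply: smoothZ => //; apply: smooth_sum => // m _; apply: smoothM => //.
    by apply: smooth_invmx => //; [exact: metric_unit|exact: smooth_metric].
  exact: smooth_spray_rhs.
by apply: (smooth_eq Uo) => z _; rewrite spray_atE.
Qed.

(** The vertical Hessian of F^2 is twice the metric, so contracting the spray with it undoes the
    inverse matrix; the factors 2, 2 and 4^-1 cancel. *)
Lemma euler_lagrange m z : U z ->
  2 * \sum_i spray_at i z * 'D_(dY i) (fun x => 'D_(dY m) energy x) z =
  spray_rhs m z.
Proof.
move=> Uz.
have -> : spray_rhs m z = \sum_j (metric_at z *m invmx (metric_at z)) m j * spray_rhs j z.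
  rewrite mulmxV ?metric_unit // (bigD1 m) //= big1 => [|j jm].
    by rewrite mxE eqxx mul1r addr0.
  by rewrite mxE eq_sym (negPf jm) mul0r.
under [RHS]eq_bigr => j _ do rewrite mxE mulr_suml.
rewrite exchange_big mulr_sumr; apply: eq_bigr => i _ /=.
under eq_bigr => j _ do rewrite -mulrA.
rewrite -mulr_sumr spray_atE metric_atE.
rewrite [in RHS](smooth_derive_comm Uo _ _ smooth_energy Uz).
by field.
Qed.

(** The metric has degree 0 in y and [spray_rhs] has degree 2. *)
Lemma fiber_homog_spray i : fiber_homog O 2 (spray_at i).
Proof.
move=> z t Uz t0; rewrite !spray_atE.
have -> : metric_at (scale_fiber t z) = metric_at z.
  apply/matrixP => a b.
  rewrite [LHS]metric_atE [RHS]metric_atE.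
  have h1 := fiber_homog_vertical Oo (basis_vec R b) smooth_energy fiber_homog_energy.
  have sb := smooth_derive (dY b) smooth_energy.
  have := fiber_homog_vertical Oo (basis_vec R a) sb h1 Uz t0.
  by rewrite expr0 mul1r => ->.
have Erhs m : spray_rhs m (scale_fiber t z) = t ^+ 2 * spray_rhs m z.
  rewrite /spray_rhs mulrBr; congr (_ - _); last first.
    exact: (fiber_homog_horizontal Oo _ smooth_energy fiber_homog_energy).
  rewrite mulr_sumr; apply: eq_bigr => k _.
  have h1 := fiber_homog_vertical Oo (basis_vec R m) smooth_energy fiber_homog_energy.
  have sm := smooth_derive (dY m) smooth_energy.
  rewrite (fiber_homog_horizontal Oo _ sm h1 Uz t0).
  by rewrite /fcoord mxE; ring.
under eq_bigr => m _ do rewrite Erhs.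
rewrite mulrCA; congr (_ * _); rewrite mulr_sumr.
by apply: eq_bigr => m _; ring.
Qed.

End LocalFinsler.

Section RiemannCoefficients.
Variables (R : realType) (n : nat).
Let V := ('rV[R]_n * 'rV[R]_n)%type.
Local Notation dX k := (@coord_dir R n (inl k)).
Local Notation dY k := (@coord_dir R n (inr k)).

Lemma riemann_coefE (f : 'rV[R]_n -> 'rV[R]_n -> R) k j z : riemann_coef f k j z.1 z.2 =
  spray_riemann (@spray_at R n f) k j z.
Proof.
have E i l x : dy l (spray f i) x.1 x.2 = connection (spray_at f) i l x.
  exact: dyE.
have E' i l : (fun x : V => dy l (spray f i) x.1 x.2) = connection (spray_at f) i l.
  by apply/funext => x; exact: E.
have E1 : dx j (spray f k) z.1 z.2 = 'D_(dX j) (spray_at f k) z by exact: dxE.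
have E2 l : dx l (dy j (spray f k)) z.1 z.2 =
    'D_(dX l) (connection (spray_at f) k j) z.
  exact: (etrans (dxE _ _ _) (congr1 (fun g => 'D_(dX l) g z) (E' k j))).
have E3 l : dy l (dy j (spray f k)) z.1 z.2 =
    'D_(dY l) (connection (spray_at f) k j) z.
  exact: (etrans (dyE _ _ _) (congr1 (fun g => 'D_(dY l) g z) (E' k j))).
have S1 : \sum_l dx l (dy j (spray f k)) z.1 z.2 * z.2 0 l =
    \sum_l 'D_(dX l) (connection (spray_at f) k j) z * fcoord l z.
  by apply: eq_bigr => l _; rewrite E2.
have S2 : \sum_l spray f l z.1 z.2 * dy l (dy j (spray f k)) z.1 z.2 =
    \sum_l spray_at f l z * 'D_(dY l) (connection (spray_at f) k j) z.
  by apply: eq_bigr => l _; rewrite E3.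
have S3 : \sum_l dy l (spray f k) z.1 z.2 * dy j (spray f l) z.1 z.2 =
    \sum_l connection (spray_at f) k l z * connection (spray_at f) l j z.
  by apply: eq_bigr => l _; rewrite !E.
rewrite /riemann_coef /spray_riemann.
exact: (f_equal4 (fun a b c d : R => 2 * a - b + 2 * c - d) E1 S1 S2 S3).
Qed.

End RiemannCoefficients.

(** * The isotropic Berwald equation on the diagonal *)

Section IsotropicBerwald.
Variables (R : realType) (n : nat) (O : set 'rV[R]_n).
Hypothesis Oo : open O.
Let V := ('rV[R]_n * 'rV[R]_n)%type.
Let U : set V := slit O.
Let Uo : open U := slit_open Oo.

Variable f : 'rV[R]_n -> 'rV[R]_n -> R.
Let F (z : V) := f z.1 z.2.
Hypothesis sf : smooth_on U F.
Hypothesis hf : forall x y (t : R), O x -> 0 < t -> f x (t *: y) = t * f x y.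
Hypothesis pf : forall x y u, O x -> y != 0 -> u != 0 ->
  0 < fundamental_form f x y u u.

Local Notation dX k := (@coord_dir R n (inl k)).
Local Notation dY k := (@coord_dir R n (inr k)).

Let sG : forall i, smooth_on U (spray_at f i) := smooth_spray Oo sf pf.
Let sE : smooth_on U (energy f) := smooth_energy Oo sf.

(** The derivative of F^2 along [w] has degree 1 in y, so Euler's identity absorbs the derivative
    along y. *)
Lemma fundamental_form_flagpole z w : U z ->
  fundamental_form f z.1 z.2 z.2 w = 2^-1 * 'D_(0, w) (energy f) z.
Proof.
move=> Uz; rewrite fundamental_formE.
have hd := fiber_homog_vertical Oo w sE (fiber_homog_energy hf).
by rewrite (euler (smooth_derive _ sE) hd Uz) mul1r.
Qed.

Lemma fundamental_form_flagpole2 z : U z ->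
  fundamental_form f z.1 z.2 z.2 z.2 = energy f z.
Proof.
move=> Uz; rewrite fundamental_form_flagpole //.
by rewrite (euler sE (fiber_homog_energy hf) Uz) mulKf.
Qed.

(** By positive definiteness, since F^2 = g_y (y, y). *)
Lemma norm_neq0 z : U z -> F z != 0.
Proof.
move=> Uz; have [Oz z0] := Uz; have := pf Oz z0 z0.
rewrite fundamental_form_flagpole2 // /energy.
by apply: contraTneq; rewrite /F => ->; rewrite mul0r ltxx.
Qed.

Lemma derive_energy w z : U z -> 'D_(0, w) (energy f) z = 2 * (F z * 'D_(0, w) F z).
Proof. by move=> Uz; rewrite (derivefM _ sf sf Uz) -/(F _); ring. Qed.

Section Direction.
Variable w : 'rV[R]_n.
Local Notation D := (fun (g : V -> R) (z : V) => 'D_((0 : 'rV[R]_n), w) g z).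

Let sD (g : V -> R) : smooth_on U g -> smooth_on U (D g).
Proof. exact: smooth_derive. Qed.

Lemma derive2_energy z : U z -> D (D (energy f)) z =
  2 * (D F z * D F z + F z * D (D F) z).
Proof.
move=> Uz; have sFD := smoothM Uo sf (sD sf).
rewrite /= (eq_in_derive Uo _ Uz (derive_energy w)) (derivefZ Uo _ _ sFD Uz).
by rewrite (derivefM _ sf (sD sf) Uz).
Qed.

Lemma fundamental_form_diag z : U z -> fundamental_form f z.1 z.2 w w =
  D F z * D F z + F z * D (D F) z.
Proof. by move=> Uz; rewrite fundamental_formE derive2_energy // mulKf. Qed.

Lemma cartan_torsion_diag z : U z -> cartan_torsion f z.1 z.2 w w w =
  2^-1 * (3 * (D F z * D (D F) z) + F z * D (D (D F)) z).
Proof.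
move=> Uz; rewrite /cartan_torsion.
rewrite (derive_snd (fun x y => fundamental_form f x y w w)) -surjective_pairing.
rewrite (eq_in_derive Uo _ Uz fundamental_form_diag); congr (_ * _).
have s1 := sD sf; have s2 := sD s1.
rewrite (derivefD _ (smoothM Uo s1 s1) (smoothM Uo sf s2) Uz).
rewrite (derivefM _ s1 s1 Uz) (derivefM _ sf s2 Uz).
by move: ('D__ _ z) (F z) ('D__ _ z) ('D__ _ z) => *; ring.
Qed.

(** As g_y (y, w) = F D F, the correction term removes exactly the square of D F from
    [fundamental_form_diag]. *)
Lemma angular_form_diag z : U z -> angular_form f z.1 z.2 w w = F z * D (D F) z.
Proof.
move=> Uz; have F0 := norm_neq0 Uz; rewrite /angular_form.
rewrite fundamental_form_diag // fundamental_form_flagpole // derive_energy //.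
rewrite -/(F z); move: (D F z) (D (D F) z) F0; move: (F z) => a b d a0.
by field.
Qed.

Lemma angular_projE z : U z ->
  angular_proj f z.1 z.2 w = w - ('D_(0, w) F z / F z) *: z.2.
Proof.
move=> Uz; have F0 := norm_neq0 Uz; rewrite /angular_proj /unit_vec -/(F z).
rewrite (fundamental_formC Oo sf _ _ Uz) (fundamental_form_mx Oo sf _ _ Uz).
rewrite -!scalemxAl mxE -(fundamental_form_mx Oo sf _ _ Uz).
rewrite fundamental_form_flagpole // derive_energy // scalerA; congr (_ - _ *: _).
by field.
Qed.

Lemma derive3_spray i z : U z ->
  D (D (D (spray_at f i))) z = berwald_curvature f z.1 z.2 w w w 0 i.
Proof.
move=> Uz; rewrite mxE; apply: (etrans (derive3_vertical Oo w (sG i) Uz)).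
apply: eq_bigr => j _; apply: eq_bigr => k _; apply: eq_bigr => l _.
have C1 : (fun x : V => dy l (spray f i) x.1 x.2) =
    (fun x => 'D_(dY l) (spray_at f i) x).
  by apply/funext => x; exact: dyE.
have C2 : (fun x : V => dy k (dy l (spray f i)) x.1 x.2) =
    (fun x => 'D_(dY k) (fun y => 'D_(dY l) (spray_at f i) y) x).
  apply/funext => x.
  exact: (etrans (dyE _ _ _) (congr1 (fun g => 'D_(dY k) g x) C1)).
have C3 : berwald_coef f i j k l z.1 z.2 =
   'D_(dY j) (fun x => 'D_(dY k) (fun y => 'D_(dY l) (spray_at f i) y) x) z.
  exact: (etrans (dyE _ _ _) (congr1 (fun g => 'D_(dY j) g z) C2)).
by rewrite C3.
Qed.

Lemma derive3_norm_coord i z : U z -> D (D (D (fun x => F x * fcoord i x))) z =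
  3 * (w 0 i * D (D F) z) + fcoord i z * D (D (D F)) z.
Proof.
move=> Uz; have sy := smooth_fcoord Oo i.
have s1 := sD sf; have s2 := sD s1.
have E1 x : U x -> D (fun x => F x * fcoord i x) x = D F x * fcoord i x + w 0 i * F x.
  move=> Ux; apply: (etrans (derivefM _ sf sy Ux)); congr (_ + _).
  by rewrite derive_fcoord mulrC.
have E2 x : U x -> D (D (fun x => F x * fcoord i x)) x =
    D (D F) x * fcoord i x + 2 * w 0 i * D F x.
  move=> Ux; rewrite (eq_in_derive Uo _ Ux E1).
  rewrite (derivefD _ (smoothM Uo s1 sy) (smoothZ Uo _ sf) Ux).
  rewrite (derivefM _ s1 sy Ux) (derivefZ Uo _ _ sf Ux) derive_fcoord /=.
  by move: ('D__ F x) ('D__ _ x) => *; ring.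
apply: (etrans (eq_in_derive Uo _ Uz E2)).
rewrite (derivefD _ (smoothM Uo s2 sy) (smoothZ Uo _ s1) Uz).
rewrite (derivefM _ s2 sy Uz) (derivefZ Uo _ _ s1 Uz) derive_fcoord /=.
by move: ('D__ _ z) ('D__ _ z) => *; ring.
Qed.

Variable c : R.
Hypothesis iso : forall x y u v w, O x -> y != 0 ->
    let h := angular_form f x y in
    let B := angular_proj f x y in
    berwald_curvature f x y u v w =
    (c * (f x y)^-1) *:
      (h u v *: B w + h v w *: B u + h w u *: B v
       + (2 * f x y * cartan_torsion f x y u v w) *: unit_vec f x y).

(** The terms in F_w F_ww coming from the angular projection and from the Cartan torsion cancel; the
    rest of the curvature is [c] times [derive3_norm_coord]. *)
Lemma derive3_quadratic_part i z : U z ->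
  D (D (D (fun x => spray_at f i x - c * (F x * fcoord i x)))) z = 0.
Proof.
move=> Uz; have [Oz z0] := Uz; have F0 := norm_neq0 Uz.
have sy := smooth_fcoord Oo i; have sFy := smoothM Uo sf sy.
have DB g h : smooth_on U g -> smooth_on U h -> forall x, U x ->
    D (fun x => g x - c * h x) x = D g x - c * D h x.
  move=> sg sh x Ux; rewrite (derivefB _ sg (smoothZ Uo c sh) Ux).
  by rewrite (derivefZ Uo _ _ sh Ux).
have s0 := sG i.
have E1 := DB _ _ s0 sFy.
have E2 x : U x -> D (D (fun x => spray_at f i x - c * (F x * fcoord i x))) x =
   D (D (spray_at f i)) x - c * D (D (fun x => F x * fcoord i x)) x.
  by move=> Ux; rewrite (eq_in_derive Uo _ Ux E1) (DB _ _ (sD s0) (sD sFy) x Ux).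
rewrite (eq_in_derive Uo _ Uz E2) (DB _ _ (sD (sD s0)) (sD (sD sFy)) z Uz).
have ES := etrans (derive3_spray i Uz)
  (congr1 (fun b : 'rV_n => b 0 i) (iso w w w Oz z0)).
apply: (etrans (congr2 (fun a b => a - c * b) ES (derive3_norm_coord i Uz))).
rewrite /= !(angular_form_diag Uz).
rewrite cartan_torsion_diag // angular_projE // /unit_vec -/(F z) !mxE.
rewrite /fcoord; move: F0 ('D__ _ z) ('D__ _ z) ('D__ _ z).
move: (F z) (w 0 i) (z.2 0 i) => a b d a0 e g h.
by field.
Qed.

End Direction.
End IsotropicBerwald.

(** * Flag curvature and the contradiction at a point *)

Section Contradiction.
Variables (R : realType) (n : nat) (O : set 'rV[R]_n).
Hypothesis Oo : open O.
Let V := ('rV[R]_n * 'rV[R]_n)%type.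
Let U : set V := slit O.
Let Uo : open U := slit_open Oo.

Variables (f : 'rV[R]_n -> 'rV[R]_n -> R) (c : R).
Let F (z : V) := f z.1 z.2.
Let P (z : V) := F (scale_fiber (-1) z).
Hypothesis n2 : (2 <= n)%N.
Hypothesis c0 : c != 0.
Hypothesis f0 : forall x y, 0 <= f x y.
Hypothesis sf : smooth_on U F.
Hypothesis hf : forall x y (t : R), O x -> 0 < t -> f x (t *: y) = t * f x y.
Hypothesis pf : forall x y u, O x -> y != 0 -> u != 0 ->
  0 < fundamental_form f x y u u.
Hypothesis iso : forall x y u v w, O x -> y != 0 ->
    let h := angular_form f x y in
    let B := angular_proj f x y in
    berwald_curvature f x y u v w =
    (c * (f x y)^-1) *:
      (h u v *: B w + h v w *: B u + h w u *: B v
       + (2 * f x y * cartan_torsion f x y u v w) *: unit_vec f x y).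
Hypothesis flag : forall x (Q : {vspace 'rV[R]_n}) (y u : 'rV[R]_n), O x ->
  \dim Q = 2%N -> y != 0 -> (<<[:: y; u]>> = Q)%VS -> 0 < flag_curvature f x y u.

Local Notation dX k := (@coord_dir R n (inl k)).
Local Notation dY k := (@coord_dir R n (inr k)).
Let G := @spray_at R n f.
Local Notation spr := (vfield (@coord_dir R n) (spray_field G)).
Local Notation hor j := (vfield (@coord_dir R n) (horizontal_field G j)).

Let sG : forall i, smooth_on U (G i) := smooth_spray Oo sf pf.
Let hG : forall i, fiber_homog O 2 (G i) := fiber_homog_spray Oo sf hf.
Let sE : smooth_on U (energy f) := smooth_energy Oo sf.
Let hE : fiber_homog O 2 (energy f) := fiber_homog_energy hf.
Let hF : fiber_homog O 1 F := fiber_homog_norm hf.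
Let sP : smooth_on U P := smooth_reverse sf.

Let F_gt0 z : U z -> 0 < F z.
Proof. by move=> Uz; rewrite lt0r (norm_neq0 Oo sf hf pf Uz) f0. Qed.

Let N1 : (-1 : R) != 0. Proof. by rewrite oppr_eq0 oner_eq0. Qed.

Let P_gt0 z : U z -> 0 < P z.
Proof. by move=> Uz; apply: F_gt0; exact: scale_fiber_slit. Qed.

Lemma spr_denergy m z : U z ->
  spr (fun x => 'D_(dY m) (energy f) x) z = 'D_(dX m) (energy f) z.
Proof.
move=> Uz; apply: (etrans (sprE _ _ _)).
apply: (etrans (congr1 (fun r => _ - r) (euler_lagrange Oo sf pf m Uz))).
rewrite /spray_rhs opprB addrCA -sumrB big1 ?addr0 // => k _.
by rewrite mulrC subrr.
Qed.

Let horF j z : U z -> hor j F z = 0.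
Proof.
move=> Uz; have := hor_energy0 Oo sG sE hE spr_denergy j Uz.
rewrite [X in X = _](vfieldM _ _ sf sf Uz) mulrC -mulrDr => /eqP.
rewrite mulf_eq0 (negPf (norm_neq0 Oo sf hf pf Uz)) /= => /eqP.
by move: (hor j _ z) => a; lra.
Qed.

Let GP k z : U z ->
  G k (scale_fiber (-1) z) = G k z - c * ((F z + P z) * fcoord k z).
Proof.
move=> Uz; pose q x := G k x - c * (F x * fcoord k x).
have sFy := smoothM Uo sf (smooth_fcoord Oo k).
have sq : smooth_on U q by exact: (smoothB Uo (sG k) (smoothZ Uo c sFy)).
have hq : fiber_homog O 2 q.
  move=> x t Ux t0; rewrite /q (hG k Ux t0) (hF Ux t0) /fcoord mxE.
  by move: (G k x) (F x) (x.2 0 k) => *; ring.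
have q3 w := derive3_quadratic_part Oo sf hf pf w iso k.
have := even_of_third_derivative n2 sq hq q3 Uz.
rewrite /q /P /fcoord mxE.
move: (G k _) (G k z) (F z) (F _) (z.2 0 k) => g h a b d E.
have -> : g = h - c * (a * d) + c * (b * (-1 * d)) by rewrite -E subrK.
by ring.
Qed.

Let v k z := F z * 'D_(dY k) P z - P z * 'D_(dY k) F z.

Lemma ratio_curvature j z : U z -> \sum_k riemann_coef f k j z.1 z.2 * v k z =
  - c ^+ 2 * F z ^+ 2 * v j z.
Proof.
move=> Uz; have := riemann_ratio Oo sG hG sf hF horF GP j Uz.
move=> <-; apply: eq_bigr => k _.
by rewrite riemann_coefE.
Qed.

Lemma ratio_derivative0 j z : U z -> v j z = 0.
Proof.
move=> Uz; have [Oz z0] := Uz.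
pose vr : 'rV[R]_n := \row_k v k z.
have [vr0|vr0] := eqVneq vr 0; first by have /rowP/(_ j) := vr0; rewrite !mxE.
(* The g_y-dual of [vr], characterised by [gu] below: g_y (u, w) = v_k w^k. *)
pose u := vr *m invmx (metric_at f z).
have ug : u *m metric_at f z = vr.
  by rewrite /u mulmxKV //; exact: (metric_unit Oo sf pf Uz).
have u0 : u != 0 by apply: contraNneq vr0 => u0; rewrite -ug u0 mul0mx.
have gu w : fundamental_form f z.1 z.2 u w = \sum_k v k z * w 0 k.
  rewrite (fundamental_form_mx Oo sf _ _ Uz) ug mxE.
  by apply: eq_bigr => k _; rewrite !mxE.
(* F and P both have degree 1, so y^k v_k = F P - P F. *)
have gyu : fundamental_form f z.1 z.2 z.2 u = 0.
  rewrite (fundamental_formC Oo sf _ _ Uz) gu.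
  have e1 := euler_sum sf hF Uz; have e2 := euler_sum sP (fiber_homog_reverse hF) Uz.
  transitivity (F z * (\sum_k z.2 0 k * 'D_(dY k) P z) -
                P z * (\sum_k z.2 0 k * 'D_(dY k) F z)).
    rewrite !mulr_sumr -sumrB; apply: eq_bigr => k _; rewrite /v.
    by move: ('D_(dY k) P z) ('D_(dY k) F z) (z.2 0 k) => *; ring.
  by rewrite e1 e2 -/(P z); ring.
have guu := pf Oz z0 u0.
have gyy := pf Oz z0 z0.
(* If y = k u, then 0 = g_y (y, u) = k g_y (u, u) forces k = 0, hence y = 0. *)
have free_yu : free [:: z.2; u].
  rewrite free_cons seq1_free u0 andbT span_seq1; apply/negP => /vlineP[k Ek].
  have := gyu; rewrite (fundamental_form_mx Oo sf _ _ Uz) Ek -!scalemxAl mxE.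
  rewrite -(fundamental_form_mx Oo sf _ _ Uz) => /eqP.
  rewrite mulf_eq0 (gt_eqF guu) orbF => /eqP k0.
  by move: z0; rewrite Ek k0 scale0r eqxx.
have Kpos := flag Oz (eqP free_yu) z0 erefl.
move: Kpos; rewrite /flag_curvature gyu expr0n subr0.
have den := mulr_gt0 gyy guu; rewrite -invr_gt0 in den.
rewrite (pmulr_lgt0 _ den) gu.
(* By duality g_y (u, R u) pairs v with R u; exchanging the sums lets [ratio_curvature] act on v. *)
have -> : \sum_k v k z * riemann_curvature f z.1 z.2 u 0 k =
   - c ^+ 2 * F z ^+ 2 * fundamental_form f z.1 z.2 u u.
  rewrite gu mulr_sumr.
  under eq_bigr => k _ do rewrite mxE mulr_sumr.
  rewrite exchange_big; apply: eq_bigr => k _ /=.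
  rewrite mulrA -ratio_curvature // mulr_suml; apply: eq_bigr => i _.
  by rewrite mulrA [v i z * _]mulrC.
rewrite mulNr mulNr oppr_gt0 => neg.
have : 0 < c ^+ 2 * F z ^+ 2 * fundamental_form f z.1 z.2 u u.
  apply: mulr_gt0 guu; apply: mulr_gt0; last by rewrite exprn_gt0 // F_gt0.
  by rewrite exprn_even_gt0.
by move=> /(lt_trans neg); rewrite ltxx.
Qed.

Let phi z := P z * (F z)^-1.

Let sphi : smooth_on U phi.
Proof.
apply: (smoothM Uo sP); apply: (smoothV Uo) sf => z Uz.
by rewrite lt0r_neq0 // F_gt0.
Qed.

(** F^2 times the derivative of P / F along [w] is F D P - P D F, a linear combination of the
    v_k. *)
Let dphi w z : U z -> 'D_(0, w) phi z = 0.
Proof.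
move=> Uz; have Fz0 := lt0r_neq0 (F_gt0 Uz).
have E : 'D_(0, w) P z = 'D_(0, w) phi z * F z + phi z * 'D_(0, w) F z.
  rewrite -(derivefM _ sphi sf Uz); apply: (eq_in_derive Uo) => // x Ux.
  by rewrite /phi divfK // lt0r_neq0 // F_gt0.
have E2 : F z * 'D_(0, w) P z - P z * 'D_(0, w) F z = 0.
  transitivity (\sum_k w 0 k * v k z).
    rewrite (derive_vertical w sP Uz) (derive_vertical w sf Uz).
    rewrite !mulr_sumr -sumrB; apply: eq_bigr => k _; rewrite /v.
    by move: ('D_(dY k) P z) ('D_(dY k) F z) => *; ring.
  by rewrite big1 // => k _; rewrite ratio_derivative0 // mulr0.
apply: (mulIf Fz0); apply: (mulIf Fz0); rewrite !mul0r -E2 E /phi.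
by move: ('D_(0, w) phi z) ('D_(0, w) F z) => *; field.
Qed.

Let phi_line x a w :
  (forall s : R, U (x, a + s *: w)) -> phi (x, a + w) = phi (x, a).
Proof.
move=> Ul.
have lineE s : (x, a + s *: w) = (x, a) + s *: ((0, w) : V) :> V.
  by rewrite -[RHS]/(x + s *: 0, a + s *: w) scaler0 addr0.
have H (s : R) : is_derive s (1 : R) (fun t : R => phi ((x, a) + t *: ((0, w) : V))) 0.
  have Us : U ((x, a) + s *: ((0, w) : V)) by rewrite -lineE.
  rewrite -(dphi w Us); apply: is_derive_line.
  exact: smooth_derivable sphi Us.
have := is_derive_0_is_cst 1 0 H.
by rewrite -!lineE scale1r scale0r addr0.
Qed.

(** A vector [w] not collinear to y lies on lines through y and through - y that avoid 0, so P / F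
    agrees at y and - y. Reversal inverts this ratio, hence P^2 = F^2, and both are positive. *)
Lemma reverse_norm z : U z -> P z = F z.
Proof.
move=> Uz; have [Oz z0] := Uz; have [w ww] := noncollinear n2 z0.
have Ul s t : (s != 0) || (t != 0) -> U (z.1, s *: z.2 + t *: w).
  move=> st; split=> //=; apply: contraTneq st => /ww[-> ->].
  by rewrite eqxx.
have E1 : phi (z.1, w) = phi z.
  have := @phi_line z.1 z.2 (w - z.2).
  rewrite [z.2 + (w - _)]addrC subrK -surjective_pairing; apply.
  move=> s; have -> : z.2 + s *: (w - z.2) = (1 - s) *: z.2 + s *: w.
    by rewrite scalerBr scalerBl scale1r addrA addrAC.
  apply: Ul; have [->|//] := eqVneq s 0; last by rewrite orbT.
  by rewrite subr0 oner_eq0.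
have E2 : phi (z.1, w) = phi (scale_fiber (-1) z).
  have := @phi_line z.1 (- z.2) (z.2 + w); rewrite addKr -scaleN1r; apply.
  move=> s; have -> : -1 *: z.2 + s *: (z.2 + w) = (s - 1) *: z.2 + s *: w.
    by rewrite scalerDr scalerBl scale1r addrA scaleN1r [- z.2 + _]addrC.
  apply: Ul; have [->|//] := eqVneq s 0; last by rewrite orbT.
  by rewrite sub0r oppr_eq0 oner_eq0.
have PS : P (scale_fiber (-1) z) = F z.
  by rewrite /P /scale_fiber /= scalerA mulN1r opprK scale1r -surjective_pairing.
have := E2; rewrite E1 /phi PS -/(P z).
have := F_gt0 Uz; have := P_gt0 Uz; move: (P z) (F z) => p q p0 q0 /eqP.
rewrite eqr_div ?lt0r_neq0 // -!expr2 => /eqP pq.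
by apply/eqP; rewrite -(eqrXn2 (n := 2)) ?ltW //; apply/eqP.
Qed.

Lemma no_isotropic_point x : O x -> False.
Proof.
(* A concrete nonzero vector: [Ordinal n2] is the index 1. *)
move=> Ox; pose y : 'rV[R]_n := basis_vec R (Ordinal n2).
have Uz : U (x, y).
  split=> //=; apply/eqP => /rowP/(_ (Ordinal n2)).
  by rewrite !mxE !eqxx => /eqP; rewrite oner_eq0.
have := spr_reverse Oo sG hG sf hF horF GP Uz.
have -> : spr (fun z => F (scale_fiber (-1) z)) (x, y) = 0.
  apply: (etrans (eq_spr Oo _ reverse_norm Uz)).
  exact: (spr_norm0 sG hG horF Uz).
rewrite -/(P _) reverse_norm // => /eqP; rewrite eq_sym.
have := F_gt0 Uz; move: (F _) => a a0.
rewrite !mulf_eq0 oppr_eq0 pnatr_eq0 (negPf c0) /= gt_eqF //.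
by rewrite addr_gt0 // mulr_gt0.
Qed.

End Contradiction.

Theorem theorem1p2 (R : realType) (n : nat) (M : manifold R n)
  (F : tangent_bundle M -> R) (n_ge2 : (2 <= n)%N) (F_finsler : is_finsler F)
  (F_pos : positive_flag_curvature F)
  (F_berwald : exists2 c : R, c != 0 & isotropic_berwald F c) :
  is_riemannian F.
Proof.
move=> ch x Ach Ox; case: F_berwald => c c0 iso; exfalso.
have [F0 sF hF pF] := F_finsler.
(* Outside the chart [local_expr] takes its default value 0, so the bound holds at every [p]. *)
have f0 p y : 0 <= local_expr F ch p y.
  by rewrite /local_expr; case: pselect.
exact: (no_isotropic_point (@chart_cod_open _ _ _ ch) n_ge2 c0 f0 (sF ch Ach)
  (fun p y t => hF ch p y t Ach) (fun p y u => pF ch p y u Ach)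
  (fun p y u v w Op => iso ch p Ach Op y u v w)
  (fun p Q y u Op => F_pos ch p Ach Op Q y u) Ox).
Qed.
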